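(* Let $x,y,n$ be nonnegative integers and let $U=\{s_1<\dots<s_u\}$, $D=\{t_1<\dots<t_d\}$, $U'=\{s'_1<\dots<s'_{u'}\}$, $D'=\{t'_1<\dots<t'_{d'}\}$ be subsets of $[x+y+n]=\{1,\dots,x+y+n\}$ such that $|U\cup D|=n$, $U\cup D=U'\cup D'$ and $U\cap D=U'\cap D'$ (so $u,d,u',d'\le n$). Let $B\subseteq[x+y+n]\setminus(U\cup D)$ with $|B|\le x$. Then $$\frac{\operatorname{M}(F_{x,y}(U;D;B))}{\operatorname{M}(F_{x,y}(U';D';B))}=\frac{\prod_{1\le i<j\le u}(s_j^2-s_i^2)\prod_{1\le i<j\le d}(t_j^2-t_i^2)}{\prod_{1\le i<j\le u'}(s'^2_j-s'^2_i)\prod_{1\le i<j\le d'}(t'^2_j-t'^2_i)}\cdot\frac{\mathbf{H}_2(2u'+2y+1)\,\mathbf{H}_2(2d'+2y+1)}{\mathbf{H}_2(2u+2y+1)\,\mathbf{H}_2(2d+2y+1)}$$ and (whenever the regions $\overline{F}$ below are defined) $$\frac{\operatorname{M}(\overline{F}_{x,y}(U;D;B))}{\operatorname{M}(\overline{F}_{x,y}(U';D';B))}=\frac{\prod_{1\le i<j\le u}(s_j-s_i)(s_j+s_i-1)\prod_{1\le i<j\le d}(t_j-t_i)(t_j+t_i-1)}{\prod_{1\le i<j\le u'}(s'_j-s'_i)(s'_j+s'_i-1)\prod_{1\le i<j\le d'}(t'_j-t'_i)(t'_j+t'_i-1)}\cdot\frac{\mathbf{H}_2(2u'+2y)\,\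mathbf{H}_2(2d'+2y)}{\mathbf{H}_2(2u+2y)\,\mathbf{H}_2(2d+2y)}.$$
   Context: Work on the triangular lattice drawn so that one family of lattice lines is horizontal; unit triangles are up-pointing or down-pointing. A lozenge is the union of two unit triangles sharing an edge; a vertical lozenge is one formed by an up-pointing triangle and the down-pointing triangle directly below it sharing its horizontal edge. For a region $R$ (finite union of unit triangles), $\operatorname{M}(R)$ is the number of lozenge tilings of $R$ (tilings respecting any barriers). The halved hexagon $F_{x,y}(U;D;B)$ (with $u=|U|$, $d=|D|$, $n=|U\cup D|$) is defined as follows. Take the lattice region whose boundary consists of: a horizontal north side of length $x+n-u$; from its east end, a north-east side of length $2y+2u$ running down and to the right along a lattice line; then a south-east side of length $2y+2d$ running down and to the left; a horizontal south side of length $x+n-d$; and a west side which, starting from the west end of the north side and going down, is a zigzag lattice path of $4y+2u+2d$ unit segments alternately going south-west and south-east, beginning with a south-west step. Let $l$ be the horizontal lattice line through the east vertex (the common endpoint of the north-east and south-east sides); its portion inside the region has length $x+y+n$, and its unit segments are numbered $1,\dots,x+y+n$ from west to east. Remove, for each $s\in U$, the up-pointing unit triangle whose base is the $s$-th segment of $l$, and for each $t\in D$ the down-pointing unit triangle whose top side is the $t$-th segment of $l$ (if $s\in U\cap D$ both are removed). For each $k\in B$, place a barrier at the $k$-th segment of $l$: tilings may not contain the vertical lozenge consisting of the two unit triangles sharing that segment. The region $\overline{F}_{x,y}(U;D;B)$ is defined identically except that the north-east side has length $2y+2u-1$, the south-east side has length $2y+2d-1$, and the west zigzag path has $4y+2u+2d-2$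 unit segments (still starting from the north-west corner with a south-west step and alternating); again $l$ is the horizontal line through the east vertex, whose portion in the region has $x+y+n$ unit segments numbered from west to east, and dents and barriers are placed in the same way. The skipping hyperfactorial is $\mathbf{H}_2(2k)=0!\,2!\,4!\cdots(2k-2)!$ and $\mathbf{H}_2(2k+1)=1!\,3!\,5!\cdots(2k-1)!$. *)

(* Defs.v *)
From HB Require Import structures.
From mathcomp Require Import all_boot all_order all_algebra.

Set Implicit Arguments.
Unset Strict Implicit.
Unset Printing Implicit Defensive.

Import GRing.Theory.

(* Lattice points are pairs (i, k): i numbers the horizontal lattice lines     *)
(* downwards (the north side lies on line 0), and k is the abscissa counted in *)
(* half unit lengths to the east. The origin is chosen so that the north-west  *)
(* corner of the regions below is (0, 1); thus (i, k) is a lattice point iff   *)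
(* i + k is odd.                                                               *)
Definition point := (nat * nat)%type.

(* The unit triangle (i, c) lies between the lines i and i.+1, and its corners *)
(* have abscissae c, c.+1 and c.+2. The type is the finite window i < h, c < w *)
(* of the lattice; each region below comes with a window that contains it.     *)
Definition triangle (h w : nat) := ('I_h * 'I_w)%type.

Definition up h w (t : triangle h w) : bool := ~~ odd (t.1 + t.2).

Definition corners h w (t : triangle h w) : seq point :=
  let: (i, c) := (val t.1, val t.2) in
  if up t then [:: (i.+1, c); (i, c.+1); (i.+1, c.+2)]
  else [:: (i, c); (i.+1, c.+1); (i, c.+2)].

(* A horizontal unit segment is represented by its west endpoint; hside t is   *)
(* the horizontal side of t, i.e. the base of an up-pointing triangle and the  *)
(* top side of a down-pointing one.                                            *)
Definition hside h w (t : triangle h w) : point :=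
  (if up t then t.1.+1 else t.1 : nat, t.2 : nat).

Definition share_edge h w (t t' : triangle h w) : bool :=
  count (mem (corners t')) (corners t) == 2.

Definition lozenge h w (L : {set triangle h w}) : bool :=
  [exists t, exists t', share_edge t t' && (L == [set t; t'])].

Definition vertical_lozenge_at h w (e : point) (L : {set triangle h w}) : bool :=
  [exists t, exists t',
    [&& up t, ~~ up t', hside t == e, hside t' == e & L == [set t; t']]].

Record region := Region {
  rows : nat;
  cols : nat;
  triangles : {set triangle rows cols};
  barriers : seq point
}.

Definition tiling (R : region)
    (P : {set {set triangle (rows R) (cols R)}}) : bool :=
  partition P (triangles R) &&
  [forall L in P, lozenge L &&
     all (fun e => ~~ vertical_lozenge_at e L) (barriers R)].

Definition M (R : region) : nat := #|[set P | @tiling R P]|.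

(* The halved hexagon with north, north-east and south-east sides of lengths   *)
(* a, p and q, and a zigzag west side of p + q unit segments; west_end i and   *)
(* east_end a p i are the abscissae of the ends of its line i.                 *)
Definition west_end (i : nat) : nat := if odd i then 0 else 1.

Definition east_end (a p i : nat) : nat :=
  if i <= p then 1 + 2 * a + i else 1 + 2 * a + p - (i - p).

Definition inside (a p q : nat) (v : point) : bool :=
  [&& v.1 <= p + q, west_end v.1 <= v.2 & v.2 <= east_end a p v.1].

Definition halved_hexagon (a p q : nat) : {set triangle (p + q) (2 * a + p)} :=
  [set t | all (inside a p q) (corners t)].

(* The s-th unit segment (s >= 1) of the horizontal line through the east      *)
(* vertex, which is line p.                                                    *)
Definition segment (p s : nat) : point := (p, west_end p + 2 * s.-1).

(* An element i of a set of ordinals stands for the segment number i.+1.       *)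
Definition segments (p N : nat) (A : {set 'I_N}) : seq point :=
  [seq segment p (val i).+1 | i : 'I_N in A].

Definition dented_halved_hexagon (a p q N : nat) (U D B : {set 'I_N}) : region :=
  @Region (p + q) (2 * a + p)
    [set t in halved_hexagon a p q |
       ~~ (up t && (hside t \in segments p U)) &&
       ~~ (~~ up t && (hside t \in segments p D))]
    (segments p B).

(* To be used when #|U :|: D| = n, so that the subtraction is a true one.      *)
Definition F (x y n : nat) (U D B : {set 'I_(x + y + n)}) : region :=
  dented_halved_hexagon (x + n - #|U|)
    (2 * y + 2 * #|U|) (2 * y + 2 * #|D|) U D B.

(* To be used, moreover, when Fbar_defined y U D (side lengths must be >= 0).  *)
Definition Fbar (x y n : nat) (U D B : {set 'I_(x + y + n)}) : region :=
  dented_halved_hexagon (x + n - #|U|)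
    (2 * y + 2 * #|U| - 1) (2 * y + 2 * #|D| - 1) U D B.

Arguments F x y n U D B : clear implicits.
Arguments Fbar x y n U D B : clear implicits.

Definition Fbar_defined (y N : nat) (U D : {set 'I_N}) : bool :=
  (1 <= 2 * y + 2 * #|U|) && (1 <= 2 * y + 2 * #|D|).

(* Skipping hyperfactorial: H2 (2k) = 0! 2! ... (2k-2)! and                    *)
(* H2 (2k+1) = 1! 3! ... (2k-1)!.                                              *)
Definition H2 (m : nat) : nat := \prod_(i < m./2) (2 * i + odd m)`!.

Local Open Scope ring_scope.

Definition lab N (i : 'I_N) : rat := i.+1%:R.

Definition prod_sq N (A : {set 'I_N}) : rat :=
  \prod_(i in A) \prod_(j in A | (i < j)%N) (lab j ^+ 2 - lab i ^+ 2).

Definition prod_bar N (A : {set 'I_N}) : rat :=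
  \prod_(i in A) \prod_(j in A | (i < j)%N)
     ((lab j - lab i) * (lab j + lab i - 1)).

(* Main.v *)
Require Import Defs.
From HB Require Import structures.
From mathcomp Require Import all_boot all_order all_algebra.
From mathcomp Require Import zify ring.

(** Cut a tiling along the line l: if S is the set of segments of l crossed by
    vertical lozenges, the number of tilings is the sum over S of the number of
    tilings of the upper half with dents at U + S times that of the lower half
    with dents at D + S. For a half with dents at the segments s_1 < ... < s_m
    this number is the determinant of the binomials C(s_k + j, 2j + 1) (even
    number of rows) or C(s_k + j - 1, 2j) (odd number of rows), which is proved
    by adding the unit triangles one by one: each addition is one Pascal
    recurrence in one row of the determinant. Both determinants are Vandermonde
    determinants up to explicit factors, in the nodes s^2, respectively s(s-1).
    In the product of the two halves the dents U and D contribute their own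
    Vandermonde products times interactions with S that only depend on the
    multiset U + D, i.e. on the union and the intersection of U and D; hence
    the sum over S cancels in the ratio. It is nonzero since |B| <= x leaves room
    for some S with |S| = y. *)

Set Implicit Arguments.
Unset Strict Implicit.
Unset Printing Implicit Defensive.

Import GRing.Theory Num.Theory Order.TTheory.

(** * Counting partitions into prescribed blocks *)

Section PartitionCount.
Variable V : finType.
Implicit Types (Q : pred {set V}) (A L K : {set V}) (P : {set {set V}}).

(** The allowed blocks form an arbitrary predicate [Q], so that barriers and excluded lozenges
    change [Q] while the set of cells stays the same. *)
Definition tiles Q A P := partition P A && [forall L in P, Q L].

Definition nb_tilings Q A := #|[set P | tiles Q A P]|.

Lemma nb_tilings_ext Q Q' A :
  (forall L, L != set0 -> L \subset A -> Q L = Q' L) -> nb_tilings Q A = nb_tilings Q' A.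
Proof.
move=> eQ; apply: eq_card => P; rewrite !inE /tiles.
case partP: (partition P A) => //=.
apply/forallP/forallP => H L; apply/implyP => LP;
  have := H L; rewrite LP /= eQ ?(partition_neq0 partP LP) ?(partitionS partP LP) //.
Qed.

Lemma nb_tilings_set0 Q : nb_tilings Q set0 = 1.
Proof.
rewrite /nb_tilings -(cards1 (set0 : {set {set V}})); apply: eq_card => P.
rewrite !inE /tiles partition_set0; case: eqP => //= ->.
by apply/forallP => L; rewrite inE.
Qed.

(** Deleting and adjoining the block [K] are inverse bijections. Being nonempty, [K] cannot be a
    block of a partition of [A :\: K]. *)
Lemma card_tiles_with Q A K : Q K -> K != set0 -> K \subset A ->
  #|[set P | tiles Q A P && (K \in P)]| = nb_tilings Q (A :\: K).
Proof.
move=> QK K0 KA; rewrite /nb_tilings.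
have KnP P : tiles Q (A :\: K) P -> K \notin P.
  case/andP=> partP _; apply/negP=> KP.
  have := partitionS partP KP; rewrite subsetD => /andP[_].
  by rewrite -setI_eq0 setIid (negbTE K0).
rewrite -[RHS](@card_in_imset _ _ (fun P => K |: P)); last first.
  move=> P1 P2; rewrite !inE => t1 t2 e.
  by rewrite -(setU1K (KnP _ t1)) e setU1K // KnP.
apply: eq_card => P; rewrite !inE; apply/idP/imsetP.
  case/andP=> /andP[partP /forallP allP] KP.
  exists (P :\ K); last by rewrite setD1K.
  rewrite inE /tiles partitionD1 //=; apply/forallP => L.
  by apply/implyP; rewrite inE => /andP[_ LP]; have := allP L; rewrite LP.
case=> P'; rewrite inE => /andP[partP /forallP allP] ->.
rewrite setU11 andbT /tiles; apply/andP; split.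
  have -> : A = K :|: (A :\: K).
    by apply/setP=> t; rewrite !inE orb_andr orbN /=; case tK: (t \in K); rewrite ?(subsetP KA _ tK).
  apply: partitionU1 => //.
  by rewrite -setI_eq0 setDE setICA setICr setI0.
apply/forallP => L; apply/implyP; rewrite in_setU1 => /orP[/eqP->//|LP].
by have := allP L; rewrite LP.
Qed.

Lemma nb_tilings_rec Q A t : t \in A ->
  nb_tilings Q A = \sum_(L | [&& Q L, t \in L & L \subset A]) nb_tilings Q (A :\: L).
Proof.
move=> tA; rewrite {1}/nb_tilings -sum1_card.
rewrite (partition_big (fun P => pblock P t)
          (fun L => [&& Q L, t \in L & L \subset A])) /=; last first.
  move=> P; rewrite inE => /andP[partP /forallP allP].
  have tP : t \in cover P by rewrite (cover_partition partP).
  have LP := pblock_mem tP.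
  have := allP (pblock P t); rewrite LP /= => ->.
  by rewrite mem_pblock tP (partitionS partP).
apply: eq_bigr => L /and3P[QL tL LA].
rewrite -card_tiles_with //; last by apply/set0Pn; exists t.
rewrite -sum1_card; apply: eq_bigl => P; rewrite !inE.
case tP: (tiles Q A P) => //=; case/andP: tP => partP _.
apply/eqP/idP => [<-|LP]; last exact: def_pblock (partition_trivIset partP) LP tL.
by apply: pblock_mem; rewrite (cover_partition partP).
Qed.

(** Deletion and contraction: the tilings are sorted by whether [K] is one of their blocks. *)
Lemma nb_tilings_delete Q A K : (Q K -> K != set0) ->
  nb_tilings Q A = nb_tilings (fun L => Q L && (L != K)) A
           + (if Q K && (K \subset A) then nb_tilings Q (A :\: K) else 0).
Proof.
move=> K0; rewrite {1}/nb_tilings.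
rewrite -(cardsID [set P : {set {set V}} | K \notin P] [set P | tiles Q A P]); congr (_ + _).
  apply: eq_card => P; rewrite !inE /tiles.
  case partP : (partition P A) => //=; rewrite ?andbF //.
  apply/andP/forallP => [[/forallP H KP] L|H].
    apply/implyP=> LP; have := H L; rewrite LP /= => ->.
    by apply: contraNneq KP => <-.
  split; last by apply/negP=> KP; have := H K; rewrite KP eqxx andbF.
  by apply/forallP=> L; apply/implyP=> LP; have := H L; rewrite LP => /andP[].
case: ifPn => [/andP[QK KA]|nK].
  rewrite -card_tiles_with ?K0 //; apply: eq_card => P.
  by rewrite !inE negbK andbC.
apply: eq_card0 => P; rewrite !inE negbK; apply/negP => /and3P[KP partP /forallP H].
case/negP: nK; have := H K; rewrite KP /= => ->.
exact: partitionS partP KP.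
Qed.

(** Induction on the size of [A1]: the block of a cell of [A1] cannot lie in [A2], hence lies in
    [A1], and removing it leaves a smaller instance. *)
Lemma nb_tilings_split Q A1 A2 : [disjoint A1 & A2] ->
  (forall L, Q L -> L \subset A1 :|: A2 -> (L \subset A1) || (L \subset A2)) ->
  nb_tilings Q (A1 :|: A2) = nb_tilings Q A1 * nb_tilings Q A2.
Proof.
elim: {A1}_.+1 {-2}A1 (ltnSn #|A1|) => // n IH A1; rewrite ltnS => sA dA noX.
have [->|[t tA]] := set_0Vmem A1; first by rewrite set0U nb_tilings_set0 mul1n.
have tA' : t \in A1 :|: A2 by rewrite inE tA.
rewrite (nb_tilings_rec Q tA) (nb_tilings_rec Q tA') big_distrl /=.
apply: eq_big => [L|L /and3P[QL tL LA]].
  apply/and3P/and3P => -[QL tL LA]; split=> //; last first.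
    exact: subset_trans LA (subsetUl _ _).
  case/orP: (noX L QL LA) => // /subsetP /(_ t tL) tA2.
  by have := disjointFr dA tA; rewrite tA2.
have LA1 : L \subset A1.
  case/orP: (noX L QL LA) => // /subsetP /(_ t tL) tA2.
  by have := disjointFr dA tA; rewrite tA2.
have -> : (A1 :|: A2) :\: L = (A1 :\: L) :|: A2.
  apply/setP=> v; rewrite !inE; case vL: (v \in L) => //=.
  by rewrite (disjointFr dA (subsetP LA1 _ vL)).
apply: IH.
- apply: leq_trans sA; apply: proper_card; apply/properP; split.
    exact: subsetDl.
  by exists t; rewrite // inE tL.
- exact: disjointWl (subsetDl _ _) dA.
move=> L' QL' L'A.
case/orP: (noX L' QL' (subset_trans L'A (setSU _ (subsetDl _ _)))) => [L'A1|->]; last by rewrite orbT.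
apply/orP; left; apply/subsetP=> v vL'; have := subsetP L'A _ vL'.
rewrite inE => /orP[//|]; by rewrite (disjointFr dA (subsetP L'A1 _ vL')).
Qed.

(** Taking images under [f] is injective on tilings, which gives one inequality; the other is the
    same one applied to [f @: A]. *)
Lemma nb_tilings_imset Q A (f : V -> V) : involutive f ->
  (forall L, Q (f @: L) = Q L) -> nb_tilings Q (f @: A) = nb_tilings Q A.
Proof.
move=> ff Qf; have f_inj := inv_inj ff.
have fK (B : {set V}) : f @: (f @: B) = B.
  by rewrite -imset_comp -[RHS]imset_id; apply: eq_imset => v /=; rewrite ff.
suff le (B : {set V}) : nb_tilings Q B <= nb_tilings Q (f @: B) by apply/anti_leq; rewrite le -{2}(fK A) le.
rewrite /nb_tilings -(@card_imset _ _ (fun P : {set {set V}} => (fun L : {set V} => f @: L) @: P)); last first.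
  by apply: imset_inj; apply: imset_inj.
apply: subset_leq_card; apply/subsetP => P' /imsetP[P]; rewrite inE => /andP[partP /forallP H] ->.
rewrite inE /tiles imset_partition ?partP //=.
apply/forallP => L; apply/implyP => /imsetP[L' L'P ->]; rewrite Qf.
by have := H L'; rewrite L'P.
Qed.

Lemma nb_tilings_balance Q A (X : {set V}) :
  (forall L, Q L -> #|L :&: X| = #|L :\: X|) ->
  nb_tilings Q A != 0 -> #|A :&: X| = #|A :\: X|.
Proof.
move=> bal; rewrite -lt0n card_gt0 => /set0Pn[P]; rewrite inE => /andP[partP /forallP H].
rewrite -!sum1_card.
rewrite (eq_bigl (fun v => (v \in A) && (v \in X))) => [|v]; last by rewrite !inE.
rewrite [RHS](eq_bigl (fun v => (v \in A) && (v \notin X))) => [|v]; last by rewrite !inE andbC.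
rewrite !(set_partition_big_cond _ partP); apply: eq_bigr => L LP.
have := H L; rewrite LP /= => /bal; rewrite -!sum1_card.
rewrite (eq_bigl (fun v => (v \in L) && (v \in X))) => [->|v]; last by rewrite !inE.
by apply: eq_bigl => v; rewrite !inE andbC.
Qed.

(** Meant for the lozenges that cross the line: [S] indexes those that occur in the tiling.
    Induction on [r], with one deletion and contraction per entry. *)
Lemma nb_tilings_cut (I : finType) (K : I -> {set V}) (r : seq I) Q A : uniq r ->
  ~~ Q set0 -> (forall i j, i != j -> [disjoint K i & K j]) ->
  nb_tilings Q A = \sum_(S : {set I} | (S \subset r) &&
               [forall s in S, Q (K s) && (K s \subset A)])
     nb_tilings (fun L => Q L && (L \notin map K r)) (A :\: \bigcup_(s in S) K s).
Proof.
move=> + + dK; elim: r Q A => [|c r IH] Q A /=.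
  move=> _ _; rewrite (big_pred1 set0) => [|S].
    by rewrite big_set0 setD0; apply: nb_tilings_ext => L _ _; rewrite andbT.
  rewrite /=; apply/andP/eqP => [[/subsetP sS _]|->].
    by apply/setP=> s; rewrite inE; apply/negP=> /sS.
  by split; [apply/subsetP=> s | apply/forallP=> s]; rewrite inE.
case/andP=> cr ur Q0.
have K0 : Q (K c) -> K c != set0 by apply: contraL => /eqP->.
rewrite (nb_tilings_delete _ K0) IH ?(negbTE Q0) //.
set Qc := fun L => Q L && (L != K c).
(* Blocks inside [A :\: K c] are nonempty and disjoint from [K c], so forbidding [K c] there changes
   nothing. *)
have -> : nb_tilings Q (A :\: K c) = nb_tilings Qc (A :\: K c).
  apply: nb_tilings_ext => L L0 sL; rewrite /Qc; case: (L =P K c) => [e|]; last by rewrite andbT.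
  move: L0 sL; rewrite e subsetD -setI_eq0 setIid; by case: eqP; rewrite ?andbF.
rewrite [nb_tilings Qc _]IH ?/Qc ?(negbTE Q0) // [RHS](bigID (fun S : {set I} => c \in S)) /= addnC.
have QcK s : s != c -> Q (K s) && (K s != K c) = Q (K s).
  move=> sc; case QK: (Q (K s)) => //=; apply: contraNneq Q0 => e.
  by have := dK _ _ sc; rewrite -setI_eq0 -e setIid => /eqP <-.
have mapE L : (Q L && (L != K c)) && (L \notin map K r) = Q L && (L \notin K c :: map K r).
  by rewrite inE negb_or andbA.
congr (_ + _); last first.
  apply: eq_big => [S|S _]; last by apply: nb_tilings_ext => L _ _; rewrite mapE.
  apply/andP/andP => [[/subsetP sS /forallP fS]|[/andP[/subsetP sS /forallP fS] cS]].
    have ncS : c \notin S by apply: contra cr => /sS.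
    split=> //; apply/andP; split; first by apply/subsetP=> s sS'; rewrite inE sS ?orbT.
    apply/forallP=> s; apply/implyP=> sS'; have := fS s; rewrite sS' /= QcK //.
    by apply: contraNneq ncS => <-.
  have sc s : s \in S -> s != c by apply: contraTneq => ->.
  split; first by apply/subsetP=> s sS'; have := sS s sS'; rewrite inE (negbTE (sc _ sS')).
  apply/forallP=> s; apply/implyP=> sS'; have := fS s; rewrite sS' /= QcK ?sc //.
case: ifPn => [/andP[QK KA]|nK]; last first.
  rewrite big1 // => S /andP[/andP[_ /forallP/(_ c)]].
  by move=> + cS; rewrite cS /= (negbTE nK).
(* The contraction term accounts for the sets that contain [c]: add [c] to those of the induction
   hypothesis. *)
rewrite [RHS](reindex_onto (fun S => c |: S) (fun S => S :\ c)) /=; last first.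
  by move=> S /andP[_ cS]; rewrite setD1K.
apply: eq_big => [S|S].
  rewrite setU11 andbT; apply/andP/andP => [[/subsetP sS /forallP fS]|].
    have ncS : c \notin S by apply: contra cr => /sS.
    rewrite setU1K // eqxx; split=> //; apply/andP; split.
      by apply/subsetP=> s; rewrite !inE => /orP[->//|/sS ->]; rewrite orbT.
    apply/forallP=> s; apply/implyP; rewrite in_setU1 => /orP[/eqP->|sS'].
      by rewrite QK.
    have := fS s; rewrite sS' /= => /andP[/andP[-> _]] /subset_trans; apply.
    exact: subsetDl.
  case=> /andP[/subsetP sS /forallP fS] /eqP e.
  have sc s : s \in S -> s != c by rewrite -e !inE => /andP[].
  split.
    by apply/subsetP=> s sS'; have := sS s; rewrite !inE sS' orbT (negbTE (sc _ sS')); apply.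
  apply/forallP=> s; apply/implyP=> sS'; have := fS s; rewrite in_setU1 sS' orbT /= QcK ?sc //.
  by case/andP=> -> KsA; rewrite subsetD KsA dK // sc.
case/andP=> /subsetP sS _.
have ncS : c \notin S by apply: contra cr => /sS.
rewrite big_setU1 //= setDDl.
by apply: nb_tilings_ext => L _ _; rewrite mapE.
Qed.

End PartitionCount.

(** * Lozenge tilings of sets of cells *)

(** Edge sharing as arithmetic on rows and columns, within reach of [lia]. *)
Definition adj (i c i' c' : nat) : bool :=
  (i == i') && ((c' == c.+1) || (c == c'.+1)) ||
  (c == c') && (odd (i + c) && (i == i'.+1) || ~~ odd (i + c) && (i' == i.+1)).

(** Corners can coincide only if the rows differ by at most 1 and the columns by at most 2. These
    finitely many offsets are computed; beyond them the relevant comparisons of coordinates are all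
    false. *)
Lemma share_edgeE h w (t t' : triangle h w) :
  share_edge t t' = adj t.1 t.2 t'.1 t'.2.
Proof.
case: t t' => [i c] [i' c']; rewrite /share_edge /corners /up /adj /=.
move: (nat_of_ord i) (nat_of_ord c) (nat_of_ord i') (nat_of_ord c').
move=> {}i {}c {}i' {}c'.
have neS n : ((n == n.+1) = false) * ((n.+1 == n) = false)
  * ((n == n.+2) = false) * ((n.+2 == n) = false)
  * ((n == n.+3) = false) * ((n.+3 == n) = false)
  * ((n == n.+4) = false) * ((n.+4 == n) = false) by do !split; lia.
have Ei : [\/ i' = i, i' = i.+1, i = i'.+1 |
   [/\ (i == i') = false, (i' == i) = false, (i.+1 == i') = false, (i' == i.+1) = false
    & (i == i'.+1) = false]].
  have [d|[d|[d|d]]] : i' = i \/ (i' = i.+1 \/ (i = i'.+1 \/ ((i.+1 < i') || (i'.+1 < i)))) by lia.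
  - exact: Or41.
  - exact: Or42.
  - exact: Or43.
  by apply: Or44; split; lia.
have Ec : (exists2 k, k <= 2 & (c' = k + c \/ c = k + c')) \/
   [/\ (c == c') = false /\ (c' == c) = false, (c.+1 == c') = false /\ (c' == c.+1) = false,
     (c == c'.+1) = false, (c.+2 == c') = false & (c == c'.+2) = false].
  have [d|[d|d]] : (c <= c' <= c + 2) \/ ((c' <= c <= c' + 2) \/ ((c.+2 < c') || (c'.+2 < c))) by lia.
  - by left; exists (c' - c); [|left]; lia.
  - by left; exists (c - c'); [|right]; lia.
  by right; split; try split; lia.
case: Ei => [->|->|->|[E1 E2 E3 E4 E5]];
  (case: Ec => [[[|[|[|//]]] _ [->|->]]|[[F1 F1'] [F2 F2'] F3 F4 F5]]);
  rewrite ?addSn ?addnS ?add0n /=; (case e: (odd (_ + _)));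
  rewrite /= ?inE ?xpair_eqE ?eqSS ?eqxx ?neS ?E1 ?E2 ?E3 ?E4 ?E5 ?F1 ?F1' ?F2 ?F2' ?F3 ?F4 ?F5 //=;
  try (case: (odd (_ + _)));
  rewrite /= ?inE ?xpair_eqE ?eqSS ?eqxx ?neS ?E1 ?E2 ?E3 ?E4 ?E5 ?F1 ?F1' ?F2 ?F2' ?F3 ?F4 ?F5 //=.
Qed.

Lemma share_edge_sym h w (t t' : triangle h w) : share_edge t t' = share_edge t' t.
Proof. by rewrite !share_edgeE /adj; lia. Qed.

Lemma share_edge_irr h w (t : triangle h w) : share_edge t t = false.
Proof. by rewrite !share_edgeE /adj; lia. Qed.

Lemma lozenge_set2 h w (t t' : triangle h w) : t != t' ->
  lozenge [set t; t'] = share_edge t t'.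
Proof.
move=> tt'; apply/idP/idP; last first.
  by move=> s; apply/existsP; exists t; apply/existsP; exists t'; rewrite s eqxx.
case/existsP=> u /existsP[v /andP[suv /eqP e]].
have uv : u != v by apply: contraTneq suv => ->; rewrite share_edge_irr.
have : t \in [set u; v] by rewrite -e !inE eqxx.
have : t' \in [set u; v] by rewrite -e !inE eqxx orbT.
rewrite !inE => /orP[] /eqP e1 /orP[] /eqP e2; move: tt' suv; rewrite e1 e2 ?eqxx //.
by rewrite share_edge_sym.
Qed.

Lemma lozenge_mem h w (L : {set triangle h w}) t : lozenge L -> t \in L ->
  exists2 t', share_edge t t' & L = [set t; t'].
Proof.
case/existsP=> u /existsP[v /andP[suv /eqP->]]; rewrite !inE => /orP[]/eqP->.
  by exists v.
by exists u; [rewrite share_edge_sym | rewrite setUC].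
Qed.

Lemma nb_tilings_lozenge_rec h w (A : {set triangle h w}) t : t \in A ->
  nb_tilings (@lozenge h w) A =
  \sum_(t' in A | share_edge t t') nb_tilings (@lozenge h w) (A :\: [set t; t']).
Proof.
move=> tA; rewrite (nb_tilings_rec _ tA).
(* The inverse map picks the second cell of the lozenge; the default [t] is not reached on a lozenge
   containing [t]. *)
rewrite (reindex_onto (fun t' => [set t; t'])
           (fun L : {set triangle h w} => odflt t [pick x in L :\ t])) /=; last first.
  move=> L /and3P[lL tL _]; have [t' st ->] := lozenge_mem lL tL.
  case: pickP => [u|/(_ t')] /=.
    by rewrite !inE => /andP[/negbTE ->] /= /eqP ->.
  rewrite !inE eqxx orbT andbT => /negbFE /eqP e.
  by move: st; rewrite e share_edge_irr.
apply: eq_bigl => t'; apply/andP/andP.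
  case=> /and3P[lL _ LA] /eqP e; split.
    by apply: (subsetP LA); rewrite !inE eqxx orbT.
  have tt' : t != t'.
    apply/eqP => et; case/existsP: lL => u /existsP[v /andP[suv /eqP e2]].
    move: e2; rewrite -et setUid => e2.
    have : u \in [set t] by rewrite e2 !inE eqxx.
    have : v \in [set t] by rewrite e2 !inE eqxx orbT.
    by rewrite !inE => /eqP ev /eqP eu; move: suv; rewrite ev eu share_edge_irr.
  by rewrite lozenge_set2 in lL.
case=> t'A st.
have tt' : t != t' by apply: contraTneq st => ->; rewrite share_edge_irr.
rewrite lozenge_set2 // st !inE eqxx; split.
  by apply/subsetP=> u; rewrite !inE => /orP[]/eqP->.
case: pickP => [u|/(_ t')] /=.
  by rewrite !inE => /andP[/negbTE ->] /= /eqP ->.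
by rewrite !inE eqxx orbT andbT eq_sym tt'.
Qed.

Definition nb_lozenge_tilings h w (P : nat -> nat -> bool) : nat :=
  nb_tilings (@lozenge h w) [set t : triangle h w | P t.1 t.2].

Lemma eq_nb_lozenge_tilings h w (P P' : nat -> nat -> bool) :
  (forall i c, i < h -> c < w -> P i c = P' i c) -> nb_lozenge_tilings h w P = nb_lozenge_tilings h w P'.
Proof.
move=> e; rewrite /nb_lozenge_tilings; congr (nb_tilings _ _); apply/setP=> t; rewrite !inE.
by apply: e.
Qed.

Definition without (P : nat -> nat -> bool) (v v' : nat * nat) : nat -> nat -> bool :=
  fun j x => [&& P j x, (j, x) != v & (j, x) != v'].

(** Serves for cells with at most two possible partners. A candidate [v1] or [v2] may fall outside
    the region; its term is then 0. *)
Lemma nb_lozenge_tilings_rec2 h w (P : nat -> nat -> bool) i c (v1 v2 : nat * nat) :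
  (forall j x, P j x -> (j < h) && (x < w)) ->
  P i c -> v1 != v2 ->
  (forall j x, P j x -> adj i c j x -> ((j, x) == v1) || ((j, x) == v2)) ->
  nb_lozenge_tilings h w P =
    (if P v1.1 v1.2 && adj i c v1.1 v1.2
     then nb_lozenge_tilings h w (without P (i, c) v1) else 0) +
    (if P v2.1 v2.2 && adj i c v2.1 v2.2
     then nb_lozenge_tilings h w (without P (i, c) v2) else 0).
Proof.
move=> inW Pic v12 nb; have /andP[ih cw] := inW _ _ Pic.
pose t : triangle h w := (Ordinal ih, Ordinal cw).
have tP : t \in [set t : triangle h w | P t.1 t.2] by rewrite inE.
rewrite {1}/nb_lozenge_tilings (nb_tilings_lozenge_rec tP).
have E v : \sum_(t' : triangle h w | [&& P t'.1 t'.2, adj i c t'.1 t'.2 & (val t'.1, val t'.2) == v])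
     nb_tilings (@lozenge h w) ([set t : triangle h w | P t.1 t.2] :\: [set t; t']) =
   (if P v.1 v.2 && adj i c v.1 v.2 then nb_lozenge_tilings h w (without P (i, c) v) else 0).
  case: ifPn => [/andP[Pv av]|nPv]; last first.
    rewrite big_pred0 // => t'; apply/negP=> /and3P[P' a' /eqP e].
    by move: nPv; rewrite -e /= P' a'.
  have /andP[vh vw] := inW _ _ Pv.
  rewrite (big_pred1 (Ordinal vh, Ordinal vw)) => [|[j x]] /=; last first.
    apply/and3P/eqP => [[_ _ /eqP ev]|[-> ->] /=]; last by rewrite -surjective_pairing.
    by congr (_, _); apply: val_inj; [have /= := congr1 fst ev | have /= := congr1 snd ev].
  rewrite /nb_lozenge_tilings; congr (nb_tilings _ _); apply/setP=> -[j x]; rewrite !inE /without /=.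
  case: v {Pv av} vh vw => v1' v2' /= vh vw.
  by rewrite negb_or !xpair_eqE -!(inj_eq val_inj) /= andbC.
rewrite -!E (eq_bigl (fun t' : triangle h w => P t'.1 t'.2 && adj i c t'.1 t'.2)); last first.
  by move=> t'; rewrite inE share_edgeE.
rewrite (bigID (fun t' : triangle h w => (val t'.1, val t'.2) == v1)) /=; congr (_ + _).
  by apply: eq_bigl => t'; rewrite andbA.
apply: eq_bigl => t'; rewrite -andbA; case P': (P _ _) => //=.
case a': (adj _ _ _ _) => //=; have := nb _ _ P' a'.
case: eqP => [->|] /=; first by rewrite (negbTE v12).
by move=> _ ->.
Qed.

(** * Trapezoids with dents *)

Section Frontier.
Variables (h w a : nat).

(* Rows j < i are complete (columns 0 .. 2a+j) and row i has its cells x < c.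
   The columns listed by z are dents: the cell (i, x) is missing if x < c, and
   the cell (i-1, x) otherwise. *)
Definition frontier (i c m : nat) (z : 'I_m -> nat) (j x : nat) : bool :=
  [&& j < i, x <= 2 * a + j & ~~ [&& j.+1 == i, c <= x & x \in codom z]] ||
  [&& j == i, x < c & x \notin codom z].

(** The parity condition makes every dent an up cell: of row [i] to the left of column [c], and of
    row [i-1] from column [c] on, in which case that row must exist. *)
Definition frontier_dents (i c m : nat) (z : 'I_m -> nat) : Prop :=
  {homo z : k l / k < l} /\
  forall k, [/\ z k <= 2 * a + i, odd (z k + i) = (c <= z k) & (c <= z k -> 0 < i)].

Definition upd m (z : 'I_m -> nat) k0 v : 'I_m -> nat :=
  fun k => if k == k0 then v else z k.

Lemma mem_upd m (z : 'I_m -> nat) k0 v x : {homo z : k l / k < l} ->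
  (x \in codom (upd z k0 v)) = (x == v) || (x \in codom z) && (x != z k0).
Proof.
move=> incz.
have injz k l : z k = z l -> k = l.
  move=> e; apply: val_inj; case: (ltngtP k l) => // /incz; rewrite e ltnn //.
apply/codomP/orP => [[k ->]|[/eqP->|/andP[/codomP[k ->] ne]]].
- rewrite /upd; case: (eqVneq k k0) => [_|kk]; first by left.
  by right; rewrite codom_f /=; apply: contra kk => /eqP/injz->.
- by exists k0; rewrite /upd eqxx.
exists k; rewrite /upd; case: eqP => // e; by rewrite e eqxx in ne.
Qed.

Local Open Scope ring_scope.

(* The step adds the down cell (i, c) and the up cell (i, c+1). If the latter is
   present, it can only be paired with (i, c). If it is a dent, then (i, c) is
   paired with the cell above it or with its left neighbour: the dent moves from
   column c+1 to c or c-1. Should c-1 already be a dent, the corresponding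
   determinant has two equal rows. *)
Lemma frontier_step (i c m : nat) (g : 'I_m -> nat -> rat) :
  (i < h)%N -> (2 * a + i < w)%N -> (c.+1 <= 2 * a + i)%N -> odd (i + c) ->
  (forall j, g j c.+1 = (0 < i)%:R * g j c + (0 < c)%:R * g j c.-1) ->
  (forall z, frontier_dents i c z ->
     (nb_lozenge_tilings h w (frontier i c z))%:R = \det (\matrix_(k, j) g j (z k))) ->
  forall z, frontier_dents i c.+2 z ->
     (nb_lozenge_tilings h w (frontier i c.+2 z))%:R = \det (\matrix_(k, j) g j (z k)).
Proof.
move=> ih iw cw oic gE IH z [incz vz].
have inW c' z' (c'w : (c' <= 2 * a + i.+1)%N) j x :
    @frontier i c' m z' j x -> (j < h)%N && (x < w)%N.
  rewrite /frontier; lia.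
have dP x : x \in codom z -> [/\ (x <= 2 * a + i)%N, odd (x + i) = (c.+2 <= x)%N & (c.+2 <= x -> 0 < i)%N].
  by case/codomP=> k ->; apply: vz.
have zc : (c \in codom z) = false by apply/negP => /dP[]; lia.
have [/codomP[k0 zk0]|nz] := boolP (c.+1 \in codom z); last first.
  have -> : nb_lozenge_tilings h w (frontier i c.+2 z) = nb_lozenge_tilings h w (frontier i c z).
    rewrite (@nb_lozenge_tilings_rec2 _ _ _ i c.+1 (i, c) (i, c.+1)) /=; first last.
    - by move=> j x; rewrite /frontier /adj !xpair_eqE; lia.
    - by rewrite xpair_eqE; lia.
    - by rewrite /frontier; lia.
    - by apply: inW; lia.
    rewrite ifT; last by rewrite /frontier /adj zc; lia.
    rewrite ifF; last by rewrite /adj; lia.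
    rewrite addn0; apply: eq_nb_lozenge_tilings => j x _ _.
    rewrite /without /frontier !xpair_eqE.
    have [xz|xz] := boolP (x \in codom z); last by lia.
    have [x1 x2 x3] := dP _ xz.
    have xc : x != c.+1 by apply: contraNneq nz => <-.
    lia.
  apply: IH; split=> // k; have [v1 v2 v3] := vz k.
  have zk : z k != c.+1 by apply: contraNneq nz => <-; exact: codom_f.
  by split; lia.
have xP x : x \in codom z -> x != c.+1 -> (x < c)%N || (c.+2 <= x)%N by move=> /dP[]; lia.
(* The dent at [c.+1] may move to [v] if it overtakes no other dent: the list stays increasing. *)
have vP (v : nat) : (v <= c)%N -> (v \notin codom z) -> (forall k, (z k < c.+1)%N -> (z k < v)%N) ->
     odd (v + i) = (c <= v)%N -> (c <= v -> 0 < i)%N -> frontier_dents i c (upd z k0 v).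
  move=> vc vz' lv ov iv; split=> [k l kl|k]; rewrite /upd.
    case: eqP => [e|_]; case: eqP => [e'|_].
    - by move: kl; rewrite e e' ltnn.
    - by have := incz _ _ kl; rewrite e -zk0; lia.
    - by apply: lv; rewrite zk0 -e'; apply: incz.
    - exact: incz.
  case: eqP => [_|/eqP kk]; first by split; lia.
  have [v1 v2 v3] := vz k; have := xP _ (codom_f z k).
  have zk : z k != c.+1.
    rewrite zk0; case: (ltngtP k k0) => [/incz|/incz|/val_inj e]; [lia | lia |].
    by rewrite e eqxx in kk.
  by move/(_ zk) => hk; split; lia.
have zlt k : (z k < c.+1)%N -> (z k < c)%N.
  by have [v1 v2 v3] := vz k; lia.
(* The recurrence of [g] splits row [k0] in the same way as the tilings split: dent moved to [c] or
   to [c.-1]. The coefficients vanish when there is no row above or no column to the left. *)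
rewrite (@determinant_multilinear _ _ _ (\matrix_(k, j) g j (upd z k0 c k))
          (\matrix_(k, j) g j (upd z k0 c.-1 k)) k0 (0 < i)%:R (0 < c)%:R); first last.
- by apply/matrixP=> k j; rewrite !mxE /upd [lift _ _ == _]eq_sym (negbTE (neq_lift _ _)).
- by apply/matrixP=> k j; rewrite !mxE /upd [lift _ _ == _]eq_sym (negbTE (neq_lift _ _)).
- by apply/rowP=> j; rewrite !mxE /upd eqxx -zk0 gE.
rewrite (@nb_lozenge_tilings_rec2 _ _ _ i c (i.-1, c) (i, c.-1)) /=; first last.
- move=> j x; rewrite /frontier /adj !xpair_eqE.
  have [->|xc] := eqVneq x c.+1; last by lia.
  by rewrite zk0 codom_f; lia.
- by rewrite xpair_eqE; lia.
- by rewrite /frontier zc; lia.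
- by apply: inW; lia.
rewrite natrD; congr (_ + _).
  case: (posnP i) => [i0|i_gt0]; last rewrite mul1r.
    by rewrite ifF ?mul0r // i0 /adj; lia.
  rewrite ifT; last by rewrite /frontier /adj zc; lia.
  rewrite -IH; last by apply: vP => //; rewrite ?zc //; lia.
  congr (_ %:R); apply: eq_nb_lozenge_tilings => j x _ _.
  rewrite /without /frontier !xpair_eqE mem_upd // -zk0.
  have [xz|xz] := boolP (x \in codom z); last first.
  have xc : x != c.+1 by apply: contraNneq xz => ->; rewrite zk0 codom_f.
  by lia.
  have := xP _ xz; lia.
case: (posnP c) => [c0|c_gt0]; last rewrite mul1r.
  by rewrite ifF ?mul0r // c0 /adj; lia.
have [/codomP[l zl]|cz] := boolP (c.-1 \in codom z).
  rewrite ifF; last by rewrite /frontier zl codom_f; lia.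
  have lk : l != k0 by apply/eqP => e; move: zl; rewrite e -zk0; lia.
  rewrite (determinant_alternate lk) // => j; rewrite !mxE /upd eqxx (negbTE lk).
  by rewrite zl.
rewrite ifT; last by rewrite /frontier /adj cz; lia.
rewrite -IH; last first.
  apply: vP => //; try lia.
  move=> k zk; have := zlt _ zk; have : z k != c.-1; last by lia.
  by apply: contraNneq cz => <-; apply: codom_f.
congr (_ %:R); apply: eq_nb_lozenge_tilings => j x _ _.
rewrite /without /frontier !xpair_eqE mem_upd // -zk0.
have [xz|xz] := boolP (x \in codom z); last first.
  have xc : x != c.+1 by apply: contraNneq xz => ->; rewrite zk0 codom_f.
  by lia.
have xc : x != c.-1 by apply: contraNneq cz => <-.
have := xP _ xz; have [] := dP _ xz; lia.
Qed.

Lemma frontier_row (i c m n : nat) (g : 'I_m -> nat -> rat) :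
  (i < h)%N -> (2 * a + i < w)%N -> (c + 2 * n <= (2 * a + i).+1)%N -> odd (i + c) ->
  (forall j c', odd (i + c') ->
     g j c'.+1 = (0 < i)%:R * g j c' + (0 < c')%:R * g j c'.-1) ->
  (forall z, frontier_dents i c z ->
     (nb_lozenge_tilings h w (frontier i c z))%:R = \det (\matrix_(k, j) g j (z k))) ->
  forall z, frontier_dents i (c + 2 * n) z ->
     (nb_lozenge_tilings h w (frontier i (c + 2 * n) z))%:R = \det (\matrix_(k, j) g j (z k)).
Proof.
move=> ih iw + oic gE IH; elim: n => [|n IHn] cn; first by rewrite muln0 addn0.
have -> : (c + 2 * n.+1 = (c + 2 * n).+2)%N by lia.
apply: frontier_step; rewrite ?ih //; try lia.
  by move=> j; apply: gE; lia.
by apply: IHn; lia.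
Qed.

(* For x = 2b + 1 and x = 2b this is C(b+1+j, 2j+1) and C(b+j, 2j); along a row
   both families satisfy the recurrence of [frontier_step]. *)
Definition path_count (j x : nat) : nat := 'C(uphalf x + j, 2 * j + odd x).

Lemma path_count0 j : path_count j 0 = (j == 0)%N.
Proof. by rewrite /path_count /= add0n addn0; case: j => //= j; rewrite bin_small //; lia. Qed.

Lemma path_count1 j : path_count j 1 = (j == 0)%N.
Proof. by rewrite /path_count /= add1n addn1; case: j => //= j; rewrite bin_small //; lia. Qed.

Lemma path_count_odd j b : path_count j (2 * b).+3 =
  (path_count j (2 * b).+2 + path_count j (2 * b).+1)%N.
Proof.
rewrite /path_count /= mul2n odd_double /= uphalf_double doubleK !addSn.
by rewrite addn0 addn1 binS addnC.
Qed.

Lemma path_count_even j b : path_count j.+1 (2 * b).+2 =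
  (path_count j (2 * b).+1 + path_count j.+1 (2 * b))%N.
Proof.
rewrite /path_count /= mul2n odd_double /= uphalf_double doubleK !addn0 addn1.
have -> : (2 * j.+1 = (2 * j).+2)%N by lia.
by rewrite !addSn addnS binS addnC.
Qed.

(** Induction on the number of rows. An odd row is filled from column 0. In an even row the cell
    [(i, 0)] is an up cell and is treated apart, so the filling starts at column 1. *)
Lemma trapezoid_det i m (z : 'I_m -> nat) :
  (i <= h)%N -> (2 * a + i <= w)%N -> m = uphalf i -> frontier_dents i 0 z ->
  (nb_lozenge_tilings h w (frontier i 0 z))%:R = \det (\matrix_(k, j) (path_count j (z k))%:R) :> rat.
Proof.
elim: i m z => [|i IH] m z ih iw mE [incz vz].
  rewrite {}mE in z incz vz *; rewrite det_mx00.
  suff -> : nb_lozenge_tilings h w (frontier 0 0 z) = 1%N by [].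
  rewrite -[RHS](nb_tilings_set0 (@lozenge h w)); congr nb_tilings.
  by apply/setP=> t; rewrite !inE /frontier !ltn0 andbF.
(* The same region, read with row [i] in progress and filled up to its last column. *)
have -> : nb_lozenge_tilings h w (frontier i.+1 0 z) = nb_lozenge_tilings h w (frontier i (2 * a + i).+1 z).
  by apply: eq_nb_lozenge_tilings => j x _ _; rewrite /frontier; case: (x \in _) => /=; lia.
have vz' : frontier_dents i (2 * a + i).+1 z.
  by split=> // k; have [v1 v2 v3] := vz k; split; lia.
have [oi|ei] := boolP (odd i).
  have e : ((2 * a + i).+1 = 0 + 2 * (2 * a + i).+1./2)%N by lia.
  rewrite [X in frontier _ X]e; rewrite [X in frontier_dents _ X]e in vz'.
  apply: (@frontier_row i 0 m _ (fun j x => (path_count j x)%:R) _ _ _ _ _ _ _ vz') => //; try lia; last first.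
    by move=> z' vz''; apply: IH => //; lia.
  move=> j c' oc; have [b ->] : exists b, c' = (2 * b)%N by exists c'./2; lia.
  rewrite (_ : (0 < i)%N) ?mul1r; last by lia.
  case: b => [|b]; first by rewrite muln0 mul0r addr0 path_count1 path_count0.
  rewrite (_ : 2 * b.+1 = (2 * b).+2)%N; last by lia.
  by rewrite path_count_odd natrD mul1r.
case: m mE z incz vz vz' => [|m] mE z incz vz vz'; first by move: mE => /=; lia.
(* In an even row there is one more dent below than above, so the functions of
   the upper line are shifted by one index and completed by 0. *)
pose g (j : 'I_m.+1) (x : nat) : rat :=
  if odd x then (if (j : nat) is j'.+1 then (path_count j' x)%:R else 0) else (path_count j x)%:R.
rewrite (_ : \matrix_(k, j) _ = \matrix_(k, j) g j (z k)); last first.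
  apply/matrixP=> k j; rewrite !mxE /g ifF //.
  by have [v1 v2 v3] := vz k; lia.
have e : ((2 * a + i).+1 = 1 + 2 * (2 * a + i)./2)%N by lia.
rewrite [X in frontier _ X]e; rewrite [X in frontier_dents _ X]e in vz'.
apply: (@frontier_row i 1 m.+1 _ g _ _ _ _ _ _ _ vz') => //; try lia.
  move=> j c' oc; have [b ->] : exists b, c' = (2 * b).+1 by exists c'./2; lia.
  rewrite /g /= mul2n odd_double /= mul1r -mul2n; case: j => [[|j] jm] /=.
    by rewrite mulr0 add0r /path_count !muln0 !add0n /= mul2n odd_double /= !bin0.
  rewrite (_ : (0 < i)%N) ?mul1r; last by move: mE => /=; lia.
  by rewrite path_count_even natrD.
move=> {incz vz e vz'}z [incz vz].
(* The cell [(i, 0)] has no partner here, so there is no tiling unless it is a dent. If it is not,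
   all dents sit in odd columns, where [g ord0] is 0, and the first column of the matrix
   vanishes. *)
have [z0|z0] := posnP (z ord0); last first.
  have zpos k : (0 < z k)%N.
    by case: (posnP k) => [k0|/(incz ord0 k)]; [rewrite (_ : k = ord0) //; apply: val_inj|lia].
  rewrite (expand_det_col _ ord0) big1 => [|k _].
    rewrite (@nb_lozenge_tilings_rec2 _ _ _ i 0 (i, 0) (i, 1))%N /=; first last.
    - by move=> j x; rewrite /frontier /adj !xpair_eqE; lia.
    - by rewrite xpair_eqE eqxx.
    - rewrite /frontier eqxx /=; apply/orP; right; apply/codomP => -[k e].
      by have := zpos k; rewrite -e.
    - by move=> j x; rewrite /frontier; lia.
    by rewrite !ifF // /frontier /adj /=; lia.
  by rewrite !mxE /g ifT ?mul0r //; have := zpos k; have [v1 v2 v3] := vz k; lia.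
pose z' (k : 'I_m) := z (lift ord0 k).
have -> : nb_lozenge_tilings h w (frontier i 1 z) = nb_lozenge_tilings h w (frontier i 0 z').
  apply: eq_nb_lozenge_tilings => j x _ _; rewrite /frontier.
  have -> : (x \in codom z) = (x == 0)%N || (x \in codom z').
    apply/codomP/orP => [[k ->]|[/eqP->|/codomP[k ->]]]; last by exists (lift ord0 k).
      have [k' ->|->] := unliftP ord0 k; last by left; rewrite z0.
      by right; apply: codom_f.
    by exists ord0.
  have z'0 : 0%N \notin codom z'.
    by apply/negP => /codomP[k e]; have := incz ord0 (lift ord0 k) isT; rewrite -/(z' k) -e.
  have [->|x0] := eqVneq x 0%N; first by rewrite (negbTE z'0); lia.
  by rewrite /=; case: (x \in _); lia.
(* The dent at column 0 gives the row [(1, 0, ..., 0)]; in the remaining minor the index shift built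
   into [g] cancels. *)
rewrite (expand_det_row _ ord0) big_ord_recl big1 => [|k _]; last first.
  by rewrite !mxE /g z0 /= path_count0 mul0r.
rewrite addr0 !mxE /g z0 /= path_count0 mul1r /cofactor expr0 mul1r.
rewrite IH; [|lia|lia|by move: mE => /=; lia|]; last first.
  split=> [k l kl|k]; first by apply: incz; rewrite /= /bump; lia.
  have := incz ord0 (lift ord0 k) isT; have [v1 v2 v3] := vz (lift ord0 k).
  by rewrite /z'; split; lia.
congr (\det _); apply/matrixP=> k j; rewrite !mxE ifT //.
have := incz ord0 (lift ord0 k) isT; have [v1 v2 v3] := vz (lift ord0 k); lia.
Qed.

End Frontier.

(** * Vandermonde evaluation of the determinants *)

Local Open Scope ring_scope.

(** The matrix is a transposed Vandermonde matrix times the matrix of coefficients of the [q j],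
    which is triangular with unit diagonal. *)
Lemma det_monic_horner (R : comNzRingType) n (q : 'I_n -> {poly R}) (x : 'I_n -> R) :
  (forall j, q j \is monic) -> (forall j, size (q j) = j.+1) ->
  \det (\matrix_(k, j) (q j).[x k]) = \prod_(i < n) \prod_(j < n | (i < j)%N) (x j - x i).
Proof.
move=> qm qs.
have -> : \matrix_(k, j) (q j).[x k] =
   (Vandermonde n (\row_j x j))^T *m \matrix_(l, j) (q j)`_l.
  apply/matrixP=> k j; rewrite !mxE (@horner_coef_wide _ n) ?qs //.
  by apply: eq_bigr => l _; rewrite !mxE mulrC.
rewrite det_mulmx det_tr det_Vandermonde -[X in _ * X]det_tr det_trig; last first.
  apply/is_trig_mxP => i j ij; rewrite !mxE nth_default // qs; lia.
rewrite [X in _ * X]big1 => [|i _]; last first.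
  by rewrite !mxE; have /monicP := qm i; rewrite lead_coefE qs.
by rewrite mulr1; apply: eq_bigr => i _; apply: eq_bigr => j _; rewrite !mxE.
Qed.

Lemma det_weighted_horner (F : fieldType) n (q : 'I_n -> {poly F}) (x u c : 'I_n -> F) :
  (forall j, q j \is monic) -> (forall j, size (q j) = j.+1) ->
  \det (\matrix_(k, j) (u k * (q j).[x k] / c j)) =
  (\prod_k u k) * (\prod_(i < n) \prod_(j < n | (i < j)%N) (x j - x i)) / \prod_j c j.
Proof.
move=> qm qs; rewrite -(det_monic_horner x qm qs).
have -> : \matrix_(k, j) (u k * (q j).[x k] / c j) =
  diag_mx (\row_k u k) *m (\matrix_(k, j) (q j).[x k]) *m diag_mx (\row_j (c j)^-1).
  by apply/matrixP=> k j; rewrite mul_mx_diag mul_diag_mx !mxE.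
rewrite !det_mulmx !det_diag; congr (_ * _ * _); first by apply: eq_bigr => k _; rewrite mxE.
by rewrite -prodfV; apply: eq_bigr => k _; rewrite mxE.
Qed.

(* e tells whether the line has an odd index (the case of Fbar). *)
Definition node_poly (e : bool) (j : nat) : {poly rat} :=
  \prod_(i < j) ('X - (i.+1%:R ^+ 2 - (e%:R * i.+1%:R))%:P).

Lemma node_poly_monic e j : node_poly e j \is monic.
Proof. by apply: monic_prod_XsubC. Qed.

Lemma size_node_poly e j : size (node_poly e j) = j.+1.
Proof. by rewrite /node_poly -big_enum /= size_prod_XsubC size_enum_ord. Qed.

Definition node (e : bool) (s : nat) : rat := s.+1%:R ^+ 2 - e%:R * s.+1%:R.

Definition node_weight (e : bool) (s : nat) : rat := if e then 1 else s.+1%:R.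

(** Put [s = b.+1]. The factors of the falling factorial pair up around its centre:
    [(s-i)(s+i) = s^2 - i^2], with the middle factor [s] left over as weight, if [e] is false;
    [(s-i)(s+i-1) = s(s-1) - i(i-1)] if [e] is true. *)
Lemma path_count_horner (e : bool) j b :
  (path_count j (~~ e + 2 * b))%:R =
  node_weight e b * (node_poly e j).[node e b] / (2 * j + ~~ e)`!%:R.
Proof.
have f0 : (2 * j + ~~ e)`!%:R != 0 :> rat by rewrite pnatr_eq0 -lt0n fact_gt0.
apply: (mulIf f0); rewrite divfK // -natrM /path_count.
have -> : odd (~~ e + 2 * b) = ~~ e by case: e {f0}; lia.
have -> : (uphalf (~~ e + 2 * b) = ~~ e + b)%N by case: e {f0}; lia.
rewrite bin_ffact {f0} /node /node_poly /node_weight.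
elim: j => [|j IH].
  rewrite big_ord0 hornerC mulr1 muln0 add0n addn0.
  by case: e => //=; rewrite ffactn1 add1n.
rewrite big_ord_recr /= hornerM mulrA -IH {IH}.
have -> : (2 * j.+1 + ~~ e = (2 * j + ~~ e).+2)%N by lia.
rewrite addnS ffactnS /= ffactnSr mulnA mulnAC !natrM !hornerE.
(* For [b < j] the falling factorial is already 0; otherwise [b - j] is a true subtraction. *)
have [lt|ge] := ltnP b j.
  rewrite (_ : (_ ^_ _ = 0)%N) ?mulr0 ?mul0r //.
  by rewrite ffact_small //; case: e; lia.
rewrite (_ : (~~ e + b + j - (2 * j + ~~ e) = b - j)%N); last by lia.
rewrite natrB //; move: (_ ^_ _)%:R => X.
by case: e => /=; rewrite -![_.+1%:R]natr1 ?natrD /=; ring.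
Qed.

Definition vand N (v : 'I_N -> rat) (A : {set 'I_N}) : rat :=
  \prod_(i in A) \prod_(j in A | (i < j)%N) (v j - v i).

Lemma ltn_enum_val N (A : {set 'I_N}) : {homo @enum_val _ (mem A) : k l / (k < l)%N}.
Proof.
move=> k l kl; have x0 := enum_val k.
rewrite !(enum_val_nth x0) -!(nth_map x0 (val x0) val) -?cardE //.
apply: (sorted_ltn_nth ltn_trans) => //; rewrite ?inE ?size_map -?cardE //.
rewrite {1}/enum_mem -enumT /=.
rewrite sorted_map; apply: sorted_filter.
  by move=> u v t; apply: ltn_trans.
by rewrite -sorted_map val_enum_ord iota_ltn_sorted.
Qed.

Lemma vand_enum_val N (v : 'I_N -> rat) (A : {set 'I_N}) :
  vand v A = \prod_(k < #|A|) \prod_(l < #|A| | (k < l)%N)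
               (v (enum_val l) - v (enum_val k)).
Proof.
rewrite /vand big_enum_val; apply: eq_bigr => k _.
rewrite big_enum_val_cond; apply: eq_bigl => l.
case: (ltngtP k l) => [/ltn_enum_val -> //|/ltn_enum_val|/val_inj ->]; last by rewrite ltnn.
by move=> lk; apply/negbTE; rewrite -leqNgt ltnW.
Qed.

Lemma prod_sqE N (A : {set 'I_N}) : prod_sq A = vand (node false) A.
Proof.
by apply: eq_bigr => i _; apply: eq_bigr => j _; rewrite /node /lab !mul0r !subr0.
Qed.

Lemma prod_barE N (A : {set 'I_N}) : prod_bar A = vand (node true) A.
Proof.
by apply: eq_bigr => i _; apply: eq_bigr => j _; rewrite /node /lab !mul1r; ring.
Qed.

Lemma node_lt e i j : (i < j)%N -> node e i < node e j.
Proof.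
move=> ij; rewrite -subr_gt0 /node.
have -> : j.+1%:R ^+ 2 - e%:R * j.+1%:R - (i.+1%:R ^+ 2 - e%:R * i.+1%:R) =
  (j%:R - i%:R) * (j.+1%:R + i.+1%:R - e%:R) :> rat.
  by rewrite -!natr1; ring.
rewrite mulr_gt0 ?subr_gt0 ?ltr_nat // -natrD ltr_nat; case: e; lia.
Qed.

Lemma vand_gt0 e N (A : {set 'I_N}) : 0 < vand (node e) A.
Proof.
by apply: prodr_gt0 => i _; apply: prodr_gt0 => j /andP[_ ij]; rewrite subr_gt0 node_lt.
Qed.

Lemma node_weight_gt0 e s : 0 < node_weight e s.
Proof. by rewrite /node_weight; case: e; rewrite ?ltr01 ?ltr0n. Qed.

Lemma H2_gt0 m : (0 < H2 m)%N.
Proof. by apply: prodn_gt0 => i; apply: fact_gt0. Qed.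

(* The cells of rows j < p of columns 0 .. 2a+j, without the up cells above the
   segments of line p numbered by W. *)
Definition trapezoid (a p N : nat) (W : {set 'I_N}) (j x : nat) : bool :=
  [&& (j < p)%N, (x <= 2 * a + j)%N &
      ~~ ((j.+1 == p) && [exists i in W, x == (west_end p + 2 * i)%N])].

(** The factorials that divide the columns of the determinant multiply to the skipping
    hyperfactorial. *)
Lemma trapezoid_count h w a p N (W : {set 'I_N}) :
  (p <= h)%N -> (2 * a + p <= w)%N -> N = (a + uphalf p)%N -> #|W| = uphalf p ->
  (nb_lozenge_tilings h w (trapezoid a p W))%:R =
  (\prod_(i in W) node_weight (odd p) i) * vand (node (odd p)) W
    / (H2 (2 * uphalf p + ~~ odd p))%:R.
Proof.
move=> ph pw NE cW.
have wE : west_end p = ~~ odd p by rewrite /west_end; case: odd.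
pose z (k : 'I_#|W|) := (~~ odd p + 2 * enum_val k)%N.
have -> : nb_lozenge_tilings h w (trapezoid a p W) = nb_lozenge_tilings h w (frontier a p 0 z).
  apply: eq_nb_lozenge_tilings => j x _ _; rewrite /trapezoid /frontier wE ltn0 andbF orbF leq0n /=.
  congr [&& _, _ & ~~ (_ && _)].
  apply/exists_inP/codomP => [[i iW /eqP->]|[k ->]]; last first.
    by exists (enum_val k); rewrite ?enum_valP.
  by exists (enum_rank_in iW i); rewrite /z enum_rankK_in.
rewrite (@trapezoid_det h w a p) //; last first.
  split=> [k l kl|k]; first by rewrite /z ltn_add2l ltn_pmul2l // ltn_enum_val.
  have pk : (0 < uphalf p)%N by rewrite -cW; apply: leq_ltn_trans (ltn_ord k).
  have : (enum_val k < a + uphalf p)%N by rewrite -NE; apply: ltn_ord.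
  rewrite /z; move: (nat_of_ord _) => b bN.
  by have [op|op] := boolP (odd p); split; lia.
rewrite (_ : \matrix_(k, j) _ = \matrix_(k < #|W|, j < #|W|)
  (node_weight (odd p) (enum_val k) * (node_poly (odd p) j).[node (odd p) (enum_val k)]
    / (2 * j + ~~ odd p)`!%:R)); last first.
  by apply/matrixP=> k j; rewrite !mxE path_count_horner.
rewrite (@det_weighted_horner _ _ (fun j : 'I_#|W| => node_poly (odd p) j)
  (fun k : 'I_#|W| => node (odd p) (enum_val k))
  (fun k : 'I_#|W| => node_weight (odd p) (enum_val k))
  (fun j : 'I_#|W| => (2 * j + ~~ odd p)`!%:R)); first last.
- by move=> j; apply: size_node_poly.
- by move=> j; apply: node_poly_monic.
rewrite vand_enum_val [in RHS]big_enum_val; congr (_ * _ / _).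
rewrite /H2 natr_prod (_ : (_./2 = #|W|)%N); last by rewrite cW; lia.
by apply: eq_bigr => j _; congr (_`!%:R); lia.
Qed.

Local Close Scope ring_scope.

(** * Cutting along the line through the east vertex *)

Lemma subset_of_card (T : finType) (A : {set T}) m : m <= #|A| ->
  exists2 S : {set T}, S \subset A & #|S| = m.
Proof.
case/card_geqP=> s [us ss sA]; exists [set:: s].
  by apply/subsetP=> v; rewrite inE => /sA.
by rewrite cardsE (card_uniqP us).
Qed.

Lemma share_edge_up h w (t t' : triangle h w) : share_edge t t' -> up t' = ~~ up t.
Proof. rewrite share_edgeE /adj /up; lia. Qed.

Lemma lozenge_up_down h w (L : {set triangle h w}) : lozenge L ->
  exists t t', [/\ up t, ~~ up t', share_edge t t' & L = [set t; t']].
Proof.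
case/existsP=> t /existsP[t' /andP[st /eqP->]]; have := share_edge_up st.
have [ut|ut] := boolP (up t) => ut'; first by exists t, t'; rewrite ut'.
by exists t', t; rewrite share_edge_sym ut' ut setUC.
Qed.

Lemma lozenge_set0 h w : ~~ lozenge (set0 : {set triangle h w}).
Proof.
apply/negP => /existsP[t /existsP[t' /andP[_ /eqP e]]].
by have := in_set0 t; rewrite e !inE eqxx.
Qed.

Lemma lozenge_balanced h w (L : {set triangle h w}) : lozenge L ->
  #|L :&: [set t | up t]| = #|L :\: [set t | up t]|.
Proof.
case/lozenge_up_down=> t [t' [ut ut' _ ->]].
rewrite (_ : _ :&: _ = [set t]); last first.
  apply/setP=> v; rewrite !inE; case: (eqVneq v t) => [->|vt] /=; first exact: ut.
  by case: eqP => // ->; apply: negbTE.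
rewrite (_ : _ :\: _ = [set t']) ?cards1 //.
apply/setP=> v; rewrite !inE; case: (eqVneq v t') => [->|vt]; first by rewrite orbT ut'.
by case: eqP => [->|]; rewrite ?andbF ?ut.
Qed.

Definition on_line (p N : nat) (W : {set 'I_N}) (c : nat) : bool :=
  [exists i in W, c == west_end p + 2 * i].

Lemma on_lineU p N (W W' : {set 'I_N}) c :
  on_line p (W :|: W') c = on_line p W c || on_line p W' c.
Proof.
apply/exists_inP/orP.
  by case=> i; rewrite inE => /orP[iW|iW] e; [left|right]; apply/exists_inP; exists i.
by case=> /exists_inP[i iW e]; exists i; rewrite // inE iW ?orbT.
Qed.

Lemma on_line_odd p N (W : {set 'I_N}) c : on_line p W c -> odd (p + c).
Proof. case/exists_inP=> i _ /eqP->; rewrite /west_end; case: ifP; lia. Qed.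

Lemma on_line_nat p N (W : {set 'I_N}) (i : 'I_N) :
  on_line p W (west_end p + 2 * i) = (i \in W).
Proof.
apply/exists_inP/idP => [[j jW /eqP e]|iW]; last by exists i.
by rewrite (_ : i = j) //; apply: val_inj => /=; lia.
Qed.

(** By parity the cell above a segment of line [p] is an up cell, so each dent costs exactly one up
    cell and no down cell. *)
Lemma card_trapezoid_up h w a p N (W : {set 'I_N}) :
  0 < p -> p <= h -> 2 * a + p <= w -> N = a + uphalf p ->
  let A W' := [set t : triangle h w | trapezoid a p W' t.1 t.2] in
  let X := [set t : triangle h w | up t] in
  #|A W :&: X| + #|W| = #|A set0 :&: X| /\ A W :\: X = A set0 :\: X.
Proof.
move=> p0 ph pw NE A X.
have no c : on_line p (set0 : {set 'I_N}) c = false.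
  by apply/exists_inP => -[i]; rewrite inE.
split; last first.
  apply/setP=> t; rewrite !inE /trapezoid -!/(on_line p _ _) no andbF.
  by rewrite /up; case o: (on_line _ _ _); [have := on_line_odd o|]; lia.
have dh : p.-1 < h by lia.
have dw (i : 'I_N) : west_end p + 2 * i < w.
  have : i < a + uphalf p by rewrite -NE.
  by rewrite /west_end; case: ifP; lia.
pose d (i : 'I_N) : triangle h w := (Ordinal dh, Ordinal (dw i)).
have d_inj : injective d by move=> i j [e]; apply: val_inj => /=; lia.
rewrite -(card_imset _ d_inj) -(cardsID (d @: W) (A set0 :&: X)) addnC; congr (_ + _).
  apply: eq_card => t; rewrite !inE; apply/idP/idP => [tW|/andP[]//].
  rewrite tW andbT; case/imsetP: tW => i iW ->.
  rewrite /trapezoid -!/(on_line p _ _) no andbF /up /=.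
  have : i < a + uphalf p by rewrite -NE.
  by rewrite /west_end; case: ifP; lia.
apply: eq_card => t; rewrite !inE /trapezoid -!/(on_line p _ _) no andbF.
have -> : (t \in d @: W) = (t.1.+1 == p) && on_line p W t.2.
  apply/imsetP/andP => [[i iW ->]|[/eqP tp /exists_inP[i iW /eqP e]]].
    by rewrite /= on_line_nat iW; split=> //; lia.
  exists i => //; case: t tp e => t1 t2 /= tp e.
  by congr (_, _); apply: val_inj => /=; lia.
by case: (_ && on_line _ _ _); rewrite ?andbF ?andbT.
Qed.

(* A set W0 with the right number of dents has a nonzero count, hence leaves as
   many up cells as down cells; W would leave a different number of up cells. *)
Lemma trapezoid_count0 h w a p N (W : {set 'I_N}) :
  0 < p -> p <= h -> 2 * a + p <= w -> N = a + uphalf p -> #|W| != uphalf p ->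
  nb_lozenge_tilings h w (trapezoid a p W) = 0.
Proof.
move=> p0 ph pw NE cW; apply/eqP; apply: contraNT cW => nz.
have [W0 _ cW0] : exists2 W0 : {set 'I_N}, W0 \subset setT & #|W0| = uphalf p.
  by apply: subset_of_card; rewrite cardsT card_ord NE leq_addl.
have nz0 : nb_lozenge_tilings h w (trapezoid a p W0) != 0.
  rewrite -(pnatr_eq0 rat) trapezoid_count //.
  rewrite mulf_neq0 ?invr_eq0 ?pnatr_eq0 -?lt0n ?H2_gt0 // mulf_neq0 //.
    by apply: lt0r_neq0; apply: prodr_gt0 => i _; apply: node_weight_gt0.
  by apply: lt0r_neq0; apply: vand_gt0.
have /= [c1 e1] := card_trapezoid_up W p0 ph pw NE.
have /= [c2 e2] := card_trapezoid_up W0 p0 ph pw NE.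
have b1 := nb_tilings_balance (@lozenge_balanced h w) nz.
have b2 := nb_tilings_balance (@lozenge_balanced h w) nz0.
move: c1; rewrite b1 e1 -c2 b2 e2 => /addnI ->.
by rewrite cW0.
Qed.

(** Reflection in a horizontal line. As [h] is even, a row goes to a row of opposite parity, so up
    and down cells are exchanged and edges are preserved. *)
Lemma nb_lozenge_tilings_flip h w (P : nat -> nat -> bool) : ~~ odd h ->
  nb_lozenge_tilings h w (fun i c => P (h - i.+1) c) = nb_lozenge_tilings h w P.
Proof.
move=> eh; pose f (t : triangle h w) : triangle h w := (rev_ord t.1, t.2).
have ff : involutive f by case=> i c; rewrite /f /= rev_ordK.
have sf t t' : share_edge (f t) (f t') = share_edge t t'.
  rewrite !share_edgeE /adj /=; have := ltn_ord t.1; have := ltn_ord t'.1; lia.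
have lf L : lozenge L -> lozenge (f @: L).
  case/existsP=> t /existsP[t' /andP[st /eqP->]].
  by apply/existsP; exists (f t); apply/existsP; exists (f t'); rewrite sf st imsetU1 imset_set1 eqxx.
have fK (B : {set triangle h w}) : f @: (f @: B) = B.
  by rewrite -imset_comp -[RHS]imset_id; apply: eq_imset => v /=; rewrite ff.
rewrite /nb_lozenge_tilings -(@nb_tilings_imset _ _ [set t : triangle h w | P t.1 t.2] f) // => [|L]; last first.
  by apply/idP/idP => /lf; rewrite ?fK.
congr nb_tilings; apply/setP=> t; rewrite -{2}(ff t) (mem_imset _ _ (inv_inj ff)) !inE.
by rewrite /f /=.
Qed.

Lemma adj_up_crossing p i c i' c' : adj i c i' c' -> ~~ odd (i + c) ->
  i < p -> p <= i' -> [/\ i.+1 = p, i' = p & c = c'].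
Proof. by rewrite /adj => e o ip ip'; split; lia. Qed.

Lemma adj_up_row p i c i' c' : adj i c i' c' -> ~~ odd (i + c) -> p <= i -> p <= i'.
Proof. by rewrite /adj; lia. Qed.

Lemma west_end_half p c : odd (p + c) -> c = west_end p + 2 * c./2.
Proof. by rewrite /west_end; case: ifP; lia. Qed.

Lemma west_end_bound a p s : 0 < p -> s < a + uphalf p -> west_end p + 2 * s < 2 * a + p.
Proof. by rewrite /west_end; case: ifP; lia. Qed.

Lemma segment_cells p i c t1 t2 : t1.+1 = p -> ~~ odd (t1 + t2) ->
  (c == t2) && (if ~~ odd (i + c) then i.+1 == p else i == p) =
  (i == t1) && (c == t2) || (i == p) && (c == t2).
Proof. by case: ifP; lia. Qed.

Section Cut.
Variables (a a' p q N : nat) (U D B : {set 'I_N}).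
Hypotheses (pq : odd p = odd q) (aa' : 2 * a + p = 2 * a' + q) (NE : N = a + uphalf p).

Let h := p + q.
Let w := 2 * a + p.
Let R := dented_halved_hexagon a p q U D B.
Let crossing (s : 'I_N) : {set triangle h w} := [set t | hside t == segment p s.+1].
Let Q (L : {set triangle h w}) : bool :=
  lozenge L && all (fun e => ~~ vertical_lozenge_at e L) (segments p B).

Lemma row_lt (t : triangle h w) : t.1 < p + q.
Proof. exact: ltn_ord. Qed.

Lemma flip_row_lt i : i < h -> (h - i.+1 < q) = (p <= i).
Proof. by rewrite /h; lia. Qed.

Lemma flip_row_p : h - p.+1 < q -> (h - p.+1).+1 == q.
Proof. by rewrite /h; lia. Qed.

Lemma M_nb_tilings : M R = nb_tilings Q (triangles R).
Proof. by []. Qed.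

Lemma mem_segments (W : {set 'I_N}) i c :
  ((i, c) \in segments p W) = (i == p) && on_line p W c.
Proof.
apply/mapP/andP => [[s]|[/eqP-> /exists_inP[s sW /eqP->]]].
  rewrite mem_enum => sW [-> ->]; split=> //.
  by apply/exists_inP; exists s.
by exists s; rewrite ?mem_enum.
Qed.

(** The lower half is a trapezoid read upside down; [a'] is the length of the south side, and [aa']
    expresses that the two halves fit along line [p]. *)
Lemma mem_halved_hexagon (t : triangle h w) :
  (t \in halved_hexagon a p q) =
  if t.1 < p then t.2 <= 2 * a + t.1 else t.2 <= 2 * a' + (h - t.1.+1).
Proof.
rewrite inE; case: t => [[i ih] [c cw]] /=; rewrite /corners /up /= /h in ih *.
case: ifP => ip; case: ifP => oic; rewrite /= /inside /west_end /east_end /= ?andbT;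
  do ?(case: ifP => ? /=); lia.
Qed.

Lemma on_line_q (W : {set 'I_N}) c : on_line q W c = on_line p W c.
Proof. by rewrite /on_line /west_end pq. Qed.

(** A crossing lozenge takes one cell on each side of the line, so [S] joins the dents of both
    halves. *)
Lemma mem_triangles_without (S : {set 'I_N}) (t : triangle h w) :
  (t \in triangles R :\: \bigcup_(s in S) crossing s) =
  trapezoid a p (U :|: S) t.1 t.2 || trapezoid a' q (D :|: S) (h - t.1.+1) t.2.
Proof.
rewrite in_setD; have -> : (t \in \bigcup_(s in S) crossing s) = ((hside t).1 == p) && on_line p S (hside t).2.
  apply/bigcupP/andP => [[s sS]|[/eqP e /exists_inP[s sS /eqP e2]]].
    by rewrite inE => /eqP ->; rewrite /segment /= eqxx on_line_nat.
  by exists s; rewrite // inE /segment -e2 /= -e -surjective_pairing.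
rewrite in_set mem_halved_hexagon !mem_segments /trapezoid.
rewrite -!/(on_line p _ _) -!/(on_line q _ _) !on_line_q !on_lineU /hside.
case: t => [[i ih] [c cw]] /=; rewrite /up /=.
have oP (W : {set 'I_N}) : on_line p W c -> odd (p + c) by apply: on_line_odd.
move: (oP U) (oP D) (oP S).
case: (on_line p U c); case: (on_line p D c); case: (on_line p S c) => oU oD oS;
case: ifP => uic; case: ifP => ip; rewrite /h /= in ih *; lia.
Qed.

Lemma crossing_up_down (s : 'I_N) (t : triangle h w) :
  (t \in crossing s) = (t.2 == west_end p + 2 * s :> nat) &&
    (if up t then t.1.+1 == p else t.1 == p :> nat).
Proof. by rewrite inE /hside /segment xpair_eqE andbC; case: up. Qed.

Lemma crossing_disjoint i j : i != j -> [disjoint crossing i & crossing j].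
Proof.
move=> ij; rewrite -setI_eq0; apply/eqP/setP=> t; rewrite in_set0 in_setI !crossing_up_down.
apply/negP => /andP[/andP[/eqP e _] /andP[/eqP e' _]].
by case/eqP: ij; apply: val_inj => /=; lia.
Qed.

Lemma Q_set0 : ~~ Q set0.
Proof. by rewrite /Q (negbTE (lozenge_set0 _ _)). Qed.

(** If one half has no rows, no lozenge crosses the line and only the empty set remains. *)
Definition admissible (S : {set 'I_N}) : bool :=
  (S == set0) || [&& 0 < p, 0 < q & S \subset ~: (U :|: D :|: B)].

Lemma crossingE (s : 'I_N) (p0 : 0 < p) (q0 : 0 < q) :
  exists t t' : triangle h w, [/\ up t, ~~ up t', share_edge t t' & crossing s = [set t; t']].
Proof.
have sN : s < a + uphalf p by rewrite -NE.
have ph : p.-1 < h by rewrite /h; lia.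
have ph' : p < h by rewrite /h; lia.
have sw : west_end p + 2 * s < w by rewrite /w /west_end; case: ifP; lia.
have ow : odd (p + (west_end p + 2 * s)) by rewrite /west_end; case: ifP; lia.
exists (Ordinal ph, Ordinal sw), (Ordinal ph', Ordinal sw).
split; rewrite ?share_edgeE /up /adj /=; try lia.
apply/setP=> -[i c]; rewrite crossing_up_down !inE !xpair_eqE -!(inj_eq val_inj) /up /=.
case: ifP; lia.
Qed.

Lemma admissibleE (S : {set 'I_N}) :
  (S \subset enum 'I_N) && [forall s in S, Q (crossing s) && (crossing s \subset triangles R)]
  = admissible S.
Proof.
have -> : S \subset enum 'I_N by apply/subsetP=> s _; rewrite mem_enum.
have tR (t : triangle h w) :
    (t \in triangles R) = trapezoid a p U t.1 t.2 || trapezoid a' q D (h - t.1.+1) t.2.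
  by have := mem_triangles_without set0 t; rewrite big_set0 setD0 !setU0.
rewrite /admissible; have [->|S0] := eqVneq S set0.
  by apply/forall_inP => s; rewrite inE.
apply/forall_inP/and3P => [H|[p0 q0 sS] s sS'].
  have HS s : s \in S -> [/\ 0 < p, 0 < q & s \notin U :|: D :|: B].
    move=> sS; have /andP[/andP[lz /allP nB] /subsetP sR] := H s sS.
    have [t [t' [ut ut' st e]]] := lozenge_up_down lz.
    have tc : t \in crossing s by rewrite e !inE eqxx.
    have tc' : t' \in crossing s by rewrite e !inE eqxx orbT.
    have := tc; rewrite crossing_up_down ut => /andP[/eqP t2 /eqP t1].
    have := tc'; rewrite crossing_up_down (negbTE ut') => /andP[/eqP t2' /eqP t1'].
    split; first by rewrite -t1.
      by have := row_lt t'; rewrite t1' -{1}[p]addn0 ltn_add2l.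
    rewrite !inE !negb_or -andbA; apply/and3P; split.
    - have := sR _ tc; rewrite tR => /orP[|] /and3P[]; last first.
        by rewrite flip_row_lt ?ltn_ord // leqNgt t1 leqnn.
      by rewrite t1 eqxx -/(on_line p U t.2) t2 on_line_nat.
    - have := sR _ tc'; rewrite tR => /orP[|] /and3P[]; first by rewrite t1' ltnn.
      rewrite -/(on_line q D t'.2) on_line_q t2' on_line_nat t1' => hq _.
      by rewrite (flip_row_p hq).
    apply/negP => sB; have := nB (segment p s.+1).
    rewrite /segment /= mem_segments eqxx on_line_nat sB /= => /(_ isT) /negP; apply.
    apply/existsP; exists t; apply/existsP; exists t'.
    by rewrite ut ut' e /hside ut (negbTE ut') t1 t2 t1' t2' !eqxx.
  case/set0Pn: S0 => s0 s0S; have [p0 q0 _] := HS s0 s0S; split=> //.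
  by apply/subsetP=> s sS; rewrite inE; have [] := HS s sS.
have [t [t' [ut ut' st e]]] := crossingE s p0 q0.
have := subsetP sS s sS'; rewrite !inE !negb_or => /andP[/andP[sU sD] sB].
apply/andP; split.
  apply/andP; split; first by apply/existsP; exists t; apply/existsP; exists t'; rewrite st e eqxx.
  apply/allP => -[i c]; rewrite mem_segments => /andP[_ oc]; apply/negP.
  case/existsP=> v /existsP[v' /and5P[uv uv' /eqP hv _ /eqP e2]].
  have : v \in crossing s by rewrite e2 !inE eqxx.
  rewrite crossing_up_down uv => /andP[/eqP v2 _].
  move: hv; rewrite /hside uv => -[_ ec]; move: oc; rewrite -ec v2 on_line_nat.
  by rewrite (negbTE sB).
apply/subsetP=> v; rewrite crossing_up_down tR /trapezoid => /andP[/eqP v2].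
rewrite -!/(on_line p _ _) -!/(on_line q _ _) !on_line_q v2 !on_line_nat (negbTE sU) (negbTE sD).
rewrite !andbF !andbT.
have sN : s < a + uphalf p by rewrite -NE.
have := west_end_bound p0 sN; case: ifP => _ cb /eqP v1.
  have le : west_end p + 2 * s <= 2 * a + v.1 by rewrite -ltnS -[X in _ < X]addnS v1.
  by rewrite le v1 leqnn.
have hq : h - p.+1 < q by rewrite flip_row_lt // /h -{1}[p]addn0 ltn_add2l.
have le : west_end p + 2 * s <= 2 * a' + (h - p.+1).
  by rewrite -ltnS -[X in _ < X]addnS (eqP (flip_row_p hq)) -aa'.
by rewrite v1 hq le orbT.
Qed.

(** Apply [nb_tilings_cut] to the crossing lozenges. With these removed or forbidden no lozenge
    meets both halves, so the counts multiply; the lower half is then reflected. *)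
Lemma M_sum : M R =
  \sum_(S | admissible S) nb_lozenge_tilings h w (trapezoid a p (U :|: S)) * nb_lozenge_tilings h w (trapezoid a' q (D :|: S)).
Proof.
rewrite M_nb_tilings (@nb_tilings_cut _ _ crossing (enum 'I_N) Q _ (enum_uniq _) Q_set0 crossing_disjoint).
apply: eq_big => [S|S _]; first exact: admissibleE.
pose A1 := [set t : triangle h w | trapezoid a p (U :|: S) t.1 t.2].
pose A2 := [set t : triangle h w | trapezoid a' q (D :|: S) (h - t.1.+1) t.2].
have -> : triangles R :\: \bigcup_(s in S) crossing s = A1 :|: A2.
  by apply/setP=> t; rewrite mem_triangles_without !inE.
have A1p t : t \in A1 -> t.1 < p by rewrite inE => /andP[].
have A2p t : t \in A2 -> p <= t.1.
  by rewrite inE => /andP[+ _]; rewrite flip_row_lt.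
rewrite nb_tilings_split; first last.
- move=> L /andP[/andP[lL _] nK] /subsetP sL.
  have [t [t' [ut ut' st e]]] := lozenge_up_down lL.
  have tL : t \in L by rewrite e !inE eqxx.
  have tL' : t' \in L by rewrite e !inE eqxx orbT.
  have sub (A' : {set triangle h w}) : t \in A' -> t' \in A' -> L \subset A'.
    by move=> tA tA'; apply/subsetP=> v; rewrite e !inE => /orP[]/eqP->.
  have := sL _ tL; have := sL _ tL'; rewrite !(in_setU _ A1) => /orP[]tA' /orP[]tA.
  + by rewrite sub.
  (* An up cell below the line has no neighbour above it. *)
  + have := adj_up_row _ _ (A2p _ tA); rewrite share_edgeE in st => /(_ _ _ _ st ut).
    by rewrite leqNgt A1p.
  (* An up cell above the line with its partner below: this is one of the forbidden crossing
     lozenges. *)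
  + case/negP: nK; rewrite share_edgeE in st.
    have [t1 t1' t2] := adj_up_crossing st ut (A1p _ tA) (A2p _ tA').
    have tw : t.2 <= 2 * a + t.1 by move: tA; rewrite inE => /and3P[].
    have sN : t.2./2 < N.
      by rewrite NE; move: ut tw t1; rewrite /up; move: (nat_of_ord _) (nat_of_ord _); clear; lia.
    have t2E : t.2 = west_end p + 2 * Ordinal sN :> nat.
      by apply: west_end_half; rewrite -{1}t1 addSn /=.
    apply/mapP; exists (Ordinal sN); first by rewrite mem_enum.
    apply/setP=> v; rewrite crossing_up_down e !inE -t2E /up (segment_cells _ _ t1 ut).
    case: v => v1 v2; rewrite [t]surjective_pairing [t']surjective_pairing !xpair_eqE.
    by rewrite -!(inj_eq val_inj) /= -t2 t1'.
  by rewrite orbC sub.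
- rewrite -setI_eq0; apply/eqP/setP=> t; rewrite in_set0 in_setI; apply/negP=> /andP[/A1p ? /A2p ?]; lia.
(* Within one half, barriers and forbidden crossings are vacuous, since both concern lozenges with
   cells on both sides of the line. *)
have E (A : {set triangle h w}) : {in A, forall t : triangle h w, t.1 < p} \/ {in A, forall t : triangle h w, p <= t.1} ->
    nb_tilings (fun L => Q L && (L \notin [seq crossing i | i <- enum 'I_N])) A = nb_tilings (@lozenge h w) A.
  move=> AP; apply: nb_tilings_ext => L _ /subsetP LA; rewrite /Q; case lL: (lozenge L) => //=.
  have nocross t t' : t \in L -> t' \in L -> up t -> ~~ up t' ->
      (hside t).1 = p -> (hside t').1 = p -> False.
    move=> /LA tA /LA tA' ut ut'; rewrite /hside ut (negbTE ut') /= => e1 e2.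
    by case: AP => AP; have := AP _ tA; have := AP _ tA'; rewrite /=; lia.
  apply/andP; split.
    apply/allP => -[i c]; rewrite mem_segments => /andP[/eqP-> _]; apply/negP.
    case/existsP=> v /existsP[v' /and5P[uv uv' /eqP hv /eqP hv' /eqP e2]].
    by apply: (nocross v v'); rewrite ?hv ?hv' // e2 !inE eqxx ?orbT.
  apply/negP => /mapP[s _ e].
  have [t [t' [ut ut' st e']]] := lozenge_up_down lL.
  have tL : t \in L by rewrite e' !inE eqxx.
  have tL' : t' \in L by rewrite e' !inE eqxx orbT.
  apply: (nocross t t') => //; move: tL tL'; rewrite e !inE => /eqP h1 /eqP h2.
    by rewrite h1.
  by rewrite h2.
rewrite !E; [|by right|by left].
congr (_ * _); rewrite -/(nb_lozenge_tilings h w (fun i c => trapezoid a' q (D :|: S) (h - i.+1) c)).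
by apply: nb_lozenge_tilings_flip; rewrite /h; lia.
Qed.

End Cut.

(** * Extracting the factor common to both regions *)

Local Open Scope ring_scope.

Lemma big_disjointU (R : Type) (idx : R) (op : Monoid.com_law idx) (T : finType)
    (A B : {set T}) (f : T -> R) : [disjoint A & B] ->
  \big[op/idx]_(i in A :|: B) f i =
  op (\big[op/idx]_(i in A) f i) (\big[op/idx]_(i in B) f i).
Proof.
by move=> dAB; rewrite -bigU //; apply: eq_bigl => i; rewrite !inE.
Qed.

(** This turns products over [U] and over [D] into data of their union and intersection. *)
Lemma prod_setUI (R : comPzRingType) (T : finType) (A B : {set T}) (f : T -> R) :
  (\prod_(i in A) f i) * (\prod_(i in B) f i) =
  (\prod_(i in A :|: B) f i) * \prod_(i in A :&: B) f i.
Proof.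
have -> : A :|: B = A :|: B :\: A by apply/setP=> i; rewrite !inE; case: (i \in A).
rewrite big_disjointU /=; last by rewrite -setI_eq0 setDE setICA setICr setI0.
by rewrite [X in _ * X = _](big_setID A) /= setIC -!mulrA; congr (_ * _); rewrite mulrC.
Qed.

(** The absolute difference of two nodes, since [node e] is increasing. *)
Definition node_gap e (i s : nat) : rat :=
  if (i < s)%N then node e s - node e i else node e i - node e s.

Lemma node_gap_gt0 e (i s : nat) : i != s -> 0 < node_gap e i s.
Proof.
rewrite neq_ltn /node_gap => /orP[is_|si]; first by rewrite is_ subr_gt0 node_lt.
by rewrite ltnNge ltnW //= subr_gt0 node_lt.
Qed.

Lemma vandU e N (A S : {set 'I_N}) : [disjoint A & S] ->
  vand (node e) (A :|: S) =
  vand (node e) A * vand (node e) S * \prod_(i in A) \prod_(s in S) node_gap e i s.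
Proof.
move=> dAS; rewrite /vand big_disjointU //=.
have splitU (i : 'I_N) : \prod_(j in A :|: S | (i < j)%N) (node e j - node e i) =
   (\prod_(j in A | (i < j)%N) (node e j - node e i)) *
   \prod_(j in S | (i < j)%N) (node e j - node e i).
  by rewrite !big_mkcondr /= big_disjointU.
under eq_bigr do rewrite splitU.
under [X in _ * X]eq_bigr do rewrite splitU.
rewrite !big_split /=.
have -> : \prod_(i in A) \prod_(s in S) node_gap e i s =
  (\prod_(i in A) \prod_(j in S | (i < j)%N) (node e j - node e i)) *
  \prod_(i in S) \prod_(j in A | (i < j)%N) (node e j - node e i).
  (* The second double product is reindexed with its outer index in [A]; since [A] and [S] are
     disjoint, the cases [i < s] and [s < i] then cover all mixed pairs. *)
  rewrite [X in _ = _ * X](exchange_big_dep (fun j => j \in A)) /=; last by move=> i j _ /andP[].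
  rewrite -big_split /=; apply: eq_bigr => i iA.
  rewrite (bigID (fun s : 'I_N => (i < s)%N)) /=; congr (_ * _).
    by apply: eq_bigr => s /andP[_ is_]; rewrite /node_gap is_.
  apply: eq_big => [s|s /andP[_ /negbTE nis]]; last by rewrite /node_gap nis.
  case sS: (s \in S) => //=; rewrite iA -leqNgt leq_eqVlt.
  case: eqP => //= /val_inj si.
  by have := disjointFr dAS iA; rewrite -si sS.
ring.
Qed.

(* Factor of the summand S, with C for the union and I for the intersection of
   U and D. *)
Definition core_term e N (C I S : {set 'I_N}) : rat :=
  (\prod_(i in C) node_weight e i) * (\prod_(i in I) node_weight e i)
  * (\prod_(i in S) node_weight e i) ^+ 2 * vand (node e) S ^+ 2
  * (\prod_(i in C) \prod_(s in S) node_gap e i s)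
  * (\prod_(i in I) \prod_(s in S) node_gap e i s).

(** The factor that cancels in the ratio. Only sets of [y] segments contribute, because the upper
    half must have [#|U| + y] dents. *)
Definition core e N (y : nat) (C I B : {set 'I_N}) : rat :=
  \sum_(S : {set 'I_N} | (S \subset ~: (C :|: B)) && (#|S| == y)) core_term e C I S.

Lemma core_term_gt0 e N (C I S : {set 'I_N}) : I \subset C -> S \subset ~: C ->
  0 < core_term e C I S.
Proof.
move=> IC SC.
have gap i : i \in C -> 0 < \prod_(s in S) node_gap e i s.
  move=> iC; apply: prodr_gt0 => s sS; apply: node_gap_gt0.
  apply: contraTneq (subsetP SC s sS) => /val_inj <-; by rewrite inE iC.
have wgt (A : {set 'I_N}) : 0 < \prod_(i in A) node_weight e i.
  by apply: prodr_gt0 => i _; apply: node_weight_gt0.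
rewrite /core_term !mulr_gt0 ?exprn_gt0 ?wgt ?vand_gt0 //.
  by apply: prodr_gt0.
by apply: prodr_gt0 => i iI; apply: gap; apply: (subsetP IC).
Qed.

Lemma core_gt0 e N (y : nat) (C I B : {set 'I_N}) :
  I \subset C -> (y <= #|~: (C :|: B)|)%N -> 0 < core e y C I B.
Proof.
move=> IC /subset_of_card[S SC cS].
have pos (S' : {set 'I_N}) : (S' \subset ~: (C :|: B)) && (#|S'| == y) -> 0 < core_term e C I S'.
  case/andP=> S'C _; apply: core_term_gt0 => //.
  by apply: subset_trans S'C _; rewrite setCS subsetUl.
rewrite /core (bigD1 S) /=; last by rewrite SC cS eqxx.
rewrite ltr_wpDr ?pos ?SC ?cS ?eqxx //.
by apply: sumr_ge0 => S' /andP[/pos/ltW].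
Qed.

(** Both families at once: [e] is false for [F] and true for [Fbar]. The two [uphalf] conditions
    make the same size [y] of [S] right for both halves. *)
Lemma M_dented (e : bool) a a' p q y N (U D B : {set 'I_N}) :
  odd p = e -> odd q = e -> (2 * a + p = 2 * a' + q)%N -> N = (a + uphalf p)%N ->
  uphalf p = (#|U| + y)%N -> uphalf q = (#|D| + y)%N ->
  (M (dented_halved_hexagon a p q U D B))%:R =
  vand (node e) U * vand (node e) D
    / ((H2 (2 * #|U| + 2 * y + ~~ e))%:R * (H2 (2 * #|D| + 2 * y + ~~ e))%:R)
  * core e y (U :|: D) (U :&: D) B.
Proof.
move=> ep eq_ aa NE pE qE; have pq : odd p = odd q by rewrite ep eq_.
have NE' : N = (a' + uphalf q)%N by lia.
rewrite (M_sum U D B pq aa NE) natr_sum /core mulr_sumr.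
rewrite (bigID (fun S : {set 'I_N} => #|S| == y)) /= [X in _ + X]big1 ?addr0; last first.
  move=> S /andP[+ cS]; rewrite /admissible.
  (* [trapezoid_count0] requires a row. If [p = 0], then [y = 0] and the only admissible set is
     empty, against [#|S| != y]. *)
  case: (posnP p) => [p0|p0].
    by move: pE cS; rewrite p0 orbF => pE + /eqP S0; rewrite S0 cards0; lia.
  move=> adm; suff -> : nb_lozenge_tilings (p + q) (2 * a + p) (trapezoid a p (U :|: S)) = 0%N by rewrite mul0n.
  apply: trapezoid_count0 => //; first exact: leq_addr.
  apply: contra cS; rewrite pE => /eqP; rewrite cardsU.
  have -> : U :&: S = set0.
    case/orP: adm => [/eqP->|/and3P[_ _ /subsetP sS]]; first by rewrite setI0.
    apply/setP=> i; rewrite !inE; apply/negP=> /andP[iU /sS].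
    by rewrite !inE iU.
  by rewrite cards0 subn0 => /addnI ->.
apply: eq_big => [S|S /andP[adm /eqP cS]].
  case: eqP => [cS|_]; rewrite ?andbF // !andbT /admissible.
  (* For [y = 0] only the empty set is left; for [y > 0] both halves have rows and [S] is nonempty,
     so the two index conditions agree. *)
  case: (posnP y) => [y0|y0].
    by move: cS; rewrite y0 => /eqP; rewrite cards_eq0 => /eqP->; rewrite eqxx sub0set.
  have -> : (0 < p)%N by lia.
  have -> : (0 < q)%N by lia.
  by rewrite -cards_eq0 cS -[y]prednK //=.
have sS : S \subset ~: (U :|: D).
  case/orP: adm => [/eqP->|/and3P[_ _ sS]]; first exact: sub0set.
  by apply: subset_trans sS _; rewrite setCS subsetUl.
have dS (A : {set 'I_N}) : A \subset U :|: D -> [disjoint A & S].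
  move=> AC; rewrite disjoint_sym disjoints_subset; apply: subset_trans sS _.
  by rewrite setCS.
have dU := dS _ (subsetUl U D); have dD := dS _ (subsetUr U D).
have cU (A : {set 'I_N}) : [disjoint A & S] -> #|A :|: S| = (#|A| + y)%N.
  by move=> dA; rewrite cardsU disjoint_setI0 // cards0 subn0 cS.
rewrite natrM !trapezoid_count ?cU ?leq_addl ?leq_addr //; last by rewrite aa.
rewrite ep eq_ !vandU // !big_disjointU //= pE qE /core_term.
have -> : (2 * (#|U| + y) + ~~ e = 2 * #|U| + 2 * y + ~~ e)%N by lia.
have -> : (2 * (#|D| + y) + ~~ e = 2 * #|D| + 2 * y + ~~ e)%N by lia.
rewrite -(prod_setUI U D) -[X in _ = _ * X]mulrA -(prod_setUI U D) invfM.
ring.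
Qed.

(** * The two families of regions and their ratios *)

Lemma M_F x y n (U D B : {set 'I_(x + y + n)}) : #|U :|: D| = n ->
  (M (F x y n U D B))%:R =
  prod_sq U * prod_sq D
    / ((H2 (2 * #|U| + 2 * y + 1))%:R * (H2 (2 * #|D| + 2 * y + 1))%:R)
  * core false y (U :|: D) (U :&: D) B.
Proof.
move=> hn; have Un : (#|U| <= n)%N by rewrite -[X in (_ <= X)%N]hn subset_leq_card ?subsetUl.
have Dn : (#|D| <= n)%N by rewrite -[X in (_ <= X)%N]hn subset_leq_card ?subsetUr.
by rewrite !prod_sqE (@M_dented false _ (x + n - #|D|) _ _ y) //; lia.
Qed.

(** [Fbar_defined] makes the side lengths truly odd, so that halving them upwards gives [y + #|U|]
    and [y + #|D|]. *)
Lemma M_Fbar x y n (U D B : {set 'I_(x + y + n)}) : #|U :|: D| = n ->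
  Fbar_defined y U D ->
  (M (Fbar x y n U D B))%:R =
  prod_bar U * prod_bar D
    / ((H2 (2 * #|U| + 2 * y))%:R * (H2 (2 * #|D| + 2 * y))%:R)
  * core true y (U :|: D) (U :&: D) B.
Proof.
move=> hn /andP[u1 d1]; have Un : (#|U| <= n)%N by rewrite -[X in (_ <= X)%N]hn subset_leq_card ?subsetUl.
have Dn : (#|D| <= n)%N by rewrite -[X in (_ <= X)%N]hn subset_leq_card ?subsetUr.
by rewrite !prod_barE (@M_dented true _ (x + n - #|D|) _ _ y) ?addn0 //; lia.
Qed.

Lemma ratio_common_factor (F : fieldType) (V V' h h' c : F) : c != 0 ->
  (V / h * c) / (V' / h' * c) = V / V' * (h' / h).
Proof. by move=> c0; rewrite -mulf_div divff // mulr1 invf_div; ring. Qed.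

Theorem theorem3p1 (x y n : nat) (U D U' D' B : {set 'I_(x + y + n)})
    (hn : #|U :|: D| = n)
    (hcup : U :|: D = U' :|: D')
    (hcap : U :&: D = U' :&: D')
    (hB : B \subset ~: (U :|: D))
    (hBx : (#|B| <= x)%N) :
  ((M (F x y n U D B))%:R / (M (F x y n U' D' B))%:R : rat) =
    (prod_sq U * prod_sq D) / (prod_sq U' * prod_sq D') *
    (((H2 (2 * #|U'| + 2 * y + 1))%:R * (H2 (2 * #|D'| + 2 * y + 1))%:R) /
     ((H2 (2 * #|U| + 2 * y + 1))%:R * (H2 (2 * #|D| + 2 * y + 1))%:R))
  /\
  (Fbar_defined y U D -> Fbar_defined y U' D' ->
   ((M (Fbar x y n U D B))%:R / (M (Fbar x y n U' D' B))%:R : rat) =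
    (prod_bar U * prod_bar D) / (prod_bar U' * prod_bar D') *
    (((H2 (2 * #|U'| + 2 * y))%:R * (H2 (2 * #|D'| + 2 * y))%:R) /
     ((H2 (2 * #|U| + 2 * y))%:R * (H2 (2 * #|D| + 2 * y))%:R))).
Proof.
have hn' : #|U' :|: D'| = n by rewrite -hcup.
have core0 e : core e y (U :|: D) (U :&: D) B != 0.
  apply/lt0r_neq0/core_gt0; first exact: subset_trans (subsetIl _ _) (subsetUl _ _).
  (* At least [(x + y + n) - n - x = y] segments are free of dents and barriers. *)
  have := cardsC (U :|: D :|: B); rewrite cardsU hn card_ord.
  by have := subset_leq_card hB; lia.
split=> [|dUD dUD'].
  by rewrite !M_F // -hcup -hcap ratio_common_factor.
by rewrite !M_Fbar // -hcup -hcap ratio_common_factor.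
Qed.
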